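(* Let $m\ge0$, let $(\vec X^m,\kappa^m_\sigma)\in\underline V(\Gamma^m)\times V(\Gamma^m)$ be given, and let $(\boldsymbol W^{m+1},\vec X^{m+1},\kappa^{m+1}_\sigma)\in\boldsymbol S^m_\Sigma\times\underline V(\Gamma^m)\times V(\Gamma^m)$ be a solution of the nonlinear system $$\langle\nabla\boldsymbol W^{m+1},\nabla\boldsymbol\varphi\rangle_\Omega-\sum_{(i,j,k)\in\Lambda}\Big\langle\pi^h_i\Big[\tfrac{\vec X^{m+1}_i-\vec X^m_i}{\tau_m}\cdot\vec\omega^{m+\frac12}_i\Big],\varphi_j-\varphi_k\Big\rangle^{(h)}_{\Gamma^m_i}=0\quad\forall\,\boldsymbol\varphi\in\boldsymbol S^m_\Sigma,$$ $$\langle\kappa^{m+1}_\sigma,\xi\rangle^h_{\Gamma^m}-\sum_{(i,j,k)\in\Lambda}\langle W^{m+1}_j-W^{m+1}_k,\xi_i\rangle^{(h)}_{\Gamma^m_i}=0\quad\forall\,\xi\in V(\Gamma^m),$$ $$\langle\kappa^{m+1}_\sigma\vec\omega^{m+\frac12},\vec\eta\rangle^h_{\Gamma^m}+\langle\sigma\nabla_s\vec X^{m+1},\nabla_s\vec\eta\rangle_{\Gamma^m}=0\quad\forall\,\vec\eta\in\underline V(\Gamma^m),$$ where the superscript $(h)$ means that either mass lumping ($h$) is used or it is omitted, consistently in both equations where it appears. Then, for each of the two choices and for each $1\le j\le3$, $$|\Omega^{m+1}_j|=|\Omega^m_j|.$$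
   Context: $\Omega\subset\mathbb R^2$ is a bounded domain, $\mathfrak T^m$ a triangulation of $\overline\Omega$, $S^m=\{v\in C(\overline\Omega)\mid v|_o\text{ affine }\forall o\in\mathfrak T^m\}$, and $\boldsymbol S^m_\Sigma=\{\boldsymbol\varphi=(\varphi_1,\varphi_2,\varphi_3)\in[S^m]^3\mid\varphi_1+\varphi_2+\varphi_3=0\}$. $\Lambda=\{(1,3,2),(2,1,3),(3,2,1)\}$. $\tau_m=t_{m+1}-t_m>0$ is the time step and $\sigma_1,\sigma_2,\sigma_3>0$ are surface tensions with $\sigma_1\le\sigma_2+\sigma_3$, $\sigma_2\le\sigma_1+\sigma_3$, $\sigma_3\le\sigma_1+\sigma_2$; $\sigma=\sigma_i$ on $\Gamma^m_i$. Curves. For $i=1,2,3$, $I=[0,1]$ is split as $I=\bigcup_{j=1}^{N_i}[q_{i,j-1},q_{i,j}]$ with $0=q_{i,0}<\dots<q_{i,N_i}=1$, $N_i\ge2$. $V^h_i$ is the space of continuous functions on $I$ that are affine on each $[q_{i,j-1},q_{i,j}]$, $\underline V^h_i=[V^h_i]^2$, and $\pi^h_i:C(I)\to V^h_i$ is the nodal interpolation operator. $V(\Gamma^m)=V^h_1\times V^h_2\times V^h_3$ and $\underline V(\Gamma^m)=\{(\vec X_1,\vec X_2,\vec X_3)\in\underline V^h_1\times\underline V^h_2\times\underline V^h_3\mid\vec X_1=\vec X_2=\vec X_3\text{ on }\partial I=\{0,1\}\}$. The polygonal curves are $\Gamma^m_i=\vec X^m_i(I)$ and $\Gamma^{m+1}_i=\vec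 X^{m+1}_i(I)$, with vertices $\vec q^m_{i,j}=\vec X^m_i(q_{i,j})$, $\vec q^{m+1}_{i,j}=\vec X^{m+1}_i(q_{i,j})$ and edges $e^m_{i,j}=[\vec q^m_{i,j-1},\vec q^m_{i,j}]$ of positive length $|e^m_{i,j}|$. The networks $\Gamma^m=\bigcup_i\Gamma^m_i$ and $\Gamma^{m+1}=\bigcup_i\Gamma^{m+1}_i$ lie in $\Omega$ and each consists of three simple curves meeting only at their two common endpoints; for $n\in\{m,m+1\}$ the network $\Gamma^n$ partitions $\Omega$ into $\Omega^n_1,\Omega^n_2,\Omega^n_3$, bounded by $\Gamma^n_2\cup\Gamma^n_3$, by $\Gamma^n_1\cup\Gamma^n_3$, and by $\Gamma^n_1\cup\Gamma^n_2\cup\partial\Omega$, respectively, and $|\Omega^n_j|$ denotes area. The curves are parameterized such that the normals $(\vec q^n_{i,j}-\vec q^n_{i,j-1})^\perp$, with $\binom ab^\perp=\binom{-b}{a}$, point from $\Omega^n_2$ into $\Omega^n_3$ on $\Gamma^n_1$, from $\Omega^n_3$ into $\Omega^n_1$ on $\Gamma^n_2$, and from $\Omega^n_1$ into $\Omega^n_2$ on $\Gamma^n_3$. Inner products. Functions on $\Gamma^m_i$ are identified with functions on $I$ via $\vec X^m_i$; bulk functions $\varphi\in S^m$ are restricted to $\Gamma^m_i$ (i.e. $\varphi\circ\vec X^m_i$). $\langle u,v\rangle_{\Gamma^m_i}=\int_{\Gamma^m_i}u\,v\,\mathrm d\mathcal H^1=\int_I u\,v\,|\partial_\rho\vec X^m_i|\,\mathrm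 d\rho$, and the mass-lumped product is $\langle u,v\rangle^h_{\Gamma^m_i}=\frac12\sum_{j=1}^{N_i}|e^m_{i,j}|\big((uv)(q_{i,j}^-)+(uv)(q_{i,j-1}^+)\big)$ with one-sided limits from within $[q_{i,j-1},q_{i,j}]$; both extend to vector- and tensor-valued functions with the Euclidean/Frobenius product. $\langle u,v\rangle^{(h)}_{\Gamma^m}=\sum_{i=1}^3\langle u_i,v_i\rangle^{(h)}_{\Gamma^m_i}$. $\langle\nabla\boldsymbol W,\nabla\boldsymbol\varphi\rangle_\Omega=\sum_{j=1}^3\int_\Omega\nabla W_j\cdot\nabla\varphi_j\,\mathrm d\mathcal L^2$. $\nabla_s$ is the arclength derivative on $\Gamma^m$, i.e. $\langle\sigma\nabla_s\vec X,\nabla_s\vec\eta\rangle_{\Gamma^m}=\sum_{i=1}^3\sigma_i\int_I\partial_\rho\vec X_i\cdot\partial_\rho\vec\eta_i\,|\partial_\rho\vec X^m_i|^{-1}\,\mathrm d\rho$. Time-averaged normals. For $t\in[t_m,t_{m+1}]$ let $\vec q^h_{i,j}(t)=\frac{t_{m+1}-t}{\tau_m}\vec q^m_{i,j}+\frac{t-t_m}{\tau_m}\vec q^{m+1}_{i,j}$, let $e^h_{i,j}(t)=[\vec q^h_{i,j-1}(t),\vec q^h_{i,j}(t)]$, and let $\vec\nu^h$ be the unit normal on it, so that $\vec\nu^h|e^h_{i,j}(t)|=(\vec q^h_{i,j}(t)-\vec q^h_{i,j-1}(t))^\perp$. Define $\vec\nu^{m+\frac12}_i=\frac1{\tau_m|e^m_{i,j}|}\int_{t_m}^{t_{m+1}}\vec\nu^h|e^h_{i,j}(t)|\,\mathrm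 dt$ on $e^m_{i,j}$, $1\le j\le N_i$, and define $\vec\omega^{m+\frac12}_i\in\underline V^h_i$ by $\langle\vec\omega^{m+\frac12}_i,\vec\xi\rangle^h_{\Gamma^m_i}=\langle\vec\nu^{m+\frac12}_i,\vec\xi\rangle_{\Gamma^m_i}$ for all $\vec\xi\in\underline V^h_i$; $\vec\omega^{m+\frac12}=(\vec\omega^{m+\frac12}_1,\vec\omega^{m+\frac12}_2,\vec\omega^{m+\frac12}_3)$. *)

(* Defs.v *)
From HB Require Import structures.
From mathcomp Require Import all_boot all_order all_algebra.
From mathcomp Require Import all_classical all_reals all_analysis.
Import Order.TTheory GRing.Theory Num.Theory.
Import numFieldNormedType.Exports.

Set Implicit Arguments.
Unset Strict Implicit.
Unset Printing Implicit Defensive.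

Local Open Scope classical_set_scope.
Local Open Scope ring_scope.

(* The plane is R * R.  The library norm on R * R is the max norm, so the     *)
(* Euclidean structure is spelled out here.                                   *)
Definition dot {R : realType} (u v : R * R) : R := u.1 * v.1 + u.2 * v.2.

Definition enorm {R : realType} (u : R * R) : R := Num.sqrt (dot u u).

Definition perp {R : realType} (u : R * R) : R * R := (- u.2, u.1).

Definition area {R : realType} (A : set (R * R)) : \bar R :=
  (@lebesgue_measure R \x @lebesgue_measure R)%E A.

Definition frontier {T : topologicalType} (A : set T) : set T :=
  closure A `\` A°.

Definition bounded_domain {R : realType} (Omega : set (R * R)) : Prop :=
  [/\ open Omega, connected Omega, Omega !=set0 & bounded_set Omega].

(* The indices 1, 2, 3 are the elements 0, 1, 2 of 'I_3. *)
Definition i1 : 'I_3 := @Ordinal 3 0 isT.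
Definition i2 : 'I_3 := @Ordinal 3 1 isT.
Definition i3 : 'I_3 := @Ordinal 3 2 isT.

Definition Lambda : seq ('I_3 * 'I_3 * 'I_3) :=
  [:: (i1, i3, i2); (i2, i1, i3); (i3, i2, i1)].

Definition conv_hull {R : realType} (s : seq (R * R)) : set (R * R) :=
  [set x | exists l : nat -> R,
     [/\ forall k, 0 <= l k, \sum_(k < size s) l k = 1
       & x = \sum_(k < size s) l k *: s`_k]].

(* Conforming: two triangles meet exactly in the convex hull of their common  *)
(* vertices, which is empty, a vertex or an edge unless they are the same     *)
(* triangle.                                                                  *)
Definition triangulation {R : realType} (Th : seq (3.-tuple (R * R)))
    (D : set (R * R)) : Prop :=
  [/\ forall o, o \in Th ->
        dot (perp (tnth o i2 - tnth o i1)) (tnth o i3 - tnth o i1) != 0,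
      \bigcup_(o in [set` Th]) conv_hull o = D
    & forall o o', o \in Th -> o' \in Th ->
        conv_hull o `&` conv_hull o' = conv_hull [seq v <- o | v \in (o' : seq _)]].

(* Functions on closure Omega are represented by total functions; their values *)
(* outside closure Omega are never used.                                       *)
Definition Sm {R : realType} (Omega : set (R * R))
    (Th : seq (3.-tuple (R * R))) (v : R * R -> R) : Prop :=
  {within closure Omega, continuous v} /\
  forall o, o \in Th ->
    exists (a : R * R) (b : R), forall x, conv_hull o x -> v x = dot a x + b.

Definition SmSigma {R : realType} (Omega : set (R * R))
    (Th : seq (3.-tuple (R * R))) (phi : 'I_3 -> R * R -> R) : Prop :=
  (forall j, Sm Omega Th (phi j)) /\
  forall x, closure Omega x -> phi i1 x + phi i2 x + phi i3 x = 0.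

(* Elements of Sm are differentiable off the mesh edges, a null set. *)
Definition grad {R : realType} (f : R * R -> R) (x : R * R) : R * R :=
  ('D_((1, 0) : R * R) f x, 'D_((0, 1) : R * R) f x).

Definition grad_ip {R : realType} (Omega : set (R * R))
    (W phi : 'I_3 -> R * R -> R) : R :=
  \sum_(j < 3) \int[(@lebesgue_measure R \x @lebesgue_measure R)%E]_(x in Omega)
    dot (grad (W j) x) (grad (phi j) x).

(* The elements of the partition of I = [0, 1] are numbered from 0: the       *)
(* element j < N is [q j, q j.+1] and q is unused beyond N.  Functions on     *)
(* I are total functions whose values outside I are never used.               *)
Definition I_partition {R : realType} (N : nat) (q : nat -> R) : Prop :=
  [/\ (2 <= N)%N, q 0%N = 0, q N = 1
    & forall j, (j < N)%N -> q j < q j.+1].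

Definition Vh {R : realType} (N : nat) (q : nat -> R) (v : R -> R) : Prop :=
  {within `[0, 1], continuous v} /\
  forall j, (j < N)%N ->
    exists a b : R, forall r, q j <= r <= q j.+1 -> v r = a * r + b.

Definition Vh2 {R : realType} (N : nat) (q : nat -> R) (X : R -> R * R) : Prop :=
  Vh N q (fun r => (X r).1) /\ Vh N q (fun r => (X r).2).

Definition Vnet {R : realType} (N : 'I_3 -> nat) (q : 'I_3 -> nat -> R)
    (xi : 'I_3 -> R -> R) : Prop :=
  forall i, Vh (N i) (q i) (xi i).

Definition Vnet2 {R : realType} (N : 'I_3 -> nat) (q : 'I_3 -> nat -> R)
    (X : 'I_3 -> R -> R * R) : Prop :=
  [/\ forall i, Vh2 (N i) (q i) (X i),
      X i1 0 = X i2 0 /\ X i2 0 = X i3 0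
    & X i1 1 = X i2 1 /\ X i2 1 = X i3 1].

(* Nodal interpolation: starting from f (q 0), the increment of f over the    *)
(* element j is picked up linearly while r runs through that element.         *)
Definition interp {R : realType} (N : nat) (q : nat -> R) (f : R -> R)
    (r : R) : R :=
  f (q 0%N) + \sum_(j < N) (f (q j.+1) - f (q j)) *
    Num.max 0 (Num.min 1 ((r - q j) / (q j.+1 - q j))).

Definition edge {R : realType} (q : nat -> R) (X : R -> R * R) (j : nat) : R * R :=
  X (q j.+1) - X (q j).

Definition deriv2 {R : realType} (X : R -> R * R) (r : R) : R * R :=
  (derive1 (fun s => (X s).1) r, derive1 (fun s => (X s).2) r).

(* Inner products on a polygonal curve X.  They are stated for the pointwise  *)
(* product f of the two arguments, which covers scalar and vector arguments.  *)
Definition curve_int {R : realType} (X : R -> R * R) (f : R -> R) : R :=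
  \int[lebesgue_measure]_(r in `[0, 1]) (f r * enorm (deriv2 X r)).

Definition lumped_int {R : realType} (N : nat) (q : nat -> R) (X : R -> R * R)
    (f : R -> R) : R :=
  2^-1 * \sum_(j < N) enorm (edge q X j) *
    (lim (f r @[r --> (q j.+1)^'-]) + lim (f r @[r --> (q j)^'+])).

(* The superscript (h): mass lumping is used iff [lumped] is true. *)
Definition opt_int {R : realType} (lumped : bool) (N : nat) (q : nat -> R)
    (X : R -> R * R) (f : R -> R) : R :=
  if lumped then lumped_int N q X f else curve_int X f.

Definition stiffness {R : realType} (sigma : 'I_3 -> R)
    (Xm X eta : 'I_3 -> R -> R * R) : R :=
  \sum_(i < 3) sigma i * \int[lebesgue_measure]_(r in `[0, 1])
    (dot (deriv2 (X i) r) (deriv2 (eta i) r) * (enorm (deriv2 (Xm i) r))^-1).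

Definition Xh {R : realType} (t0 t1 : R) (X0 X1 : R -> R * R) (s : R)
    (r : R) : R * R :=
  ((t1 - s) / (t1 - t0)) *: X0 r + ((s - t0) / (t1 - t0)) *: X1 r.

(* Equal to 0 if the edge is degenerate; in [nu_edge] it is multiplied by the *)
(* length of the edge.                                                        *)
Definition unit_normal {R : realType} (q : nat -> R) (X : R -> R * R)
    (j : nat) : R * R :=
  (enorm (edge q X j))^-1 *: perp (edge q X j).

Definition nu_edge {R : realType} (t0 t1 : R) (q : nat -> R)
    (X0 X1 : R -> R * R) (j : nat) : R * R :=
  let g s := enorm (edge q (Xh t0 t1 X0 X1 s) j) *:
             unit_normal q (Xh t0 t1 X0 X1 s) j in
  ((t1 - t0) * enorm (edge q X0 j))^-1 *:
    (\int[lebesgue_measure]_(s in `[t0, t1]) (g s).1,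
     \int[lebesgue_measure]_(s in `[t0, t1]) (g s).2).

(* Piecewise constant; the value 0 at the nodes is irrelevant. *)
Definition nu_half {R : realType} (t0 t1 : R) (N : nat) (q : nat -> R)
    (X0 X1 : R -> R * R) (r : R) : R * R :=
  \sum_(j < N | q j < r < q j.+1) nu_edge t0 t1 q X0 X1 j.

Definition is_omega_half {R : realType} (t0 t1 : R) (N : nat) (q : nat -> R)
    (X0 X1 omega : R -> R * R) : Prop :=
  Vh2 N q omega /\
  forall xi : R -> R * R, Vh2 N q xi ->
    lumped_int N q X0 (fun r => dot (omega r) (xi r)) =
    curve_int X0 (fun r => dot (nu_half t0 t1 N q X0 X1 r) (xi r)).

Definition curve {R : realType} (X : R -> R * R) : set (R * R) := X @` `[0, 1].

Definition simple_network {R : realType} (Omega : set (R * R))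
    (X : 'I_3 -> R -> R * R) : Prop :=
  [/\ forall i, curve (X i) `<=` Omega,
      forall i, {in `[0, 1] &, injective (X i)}
    & forall i k, i != k ->
        curve (X i) `&` curve (X k) = [set X i 0; X i 1]].

Definition network_partition {R : realType} (Omega : set (R * R))
    (X : 'I_3 -> R -> R * R) (Om : 'I_3 -> set (R * R)) : Prop :=
  [/\ forall j, open (Om j),
      forall j k, j != k -> Om j `&` Om k = set0,
      \bigcup_j Om j = Omega `\` \bigcup_i curve (X i)
    & [/\ frontier (Om i1) = curve (X i2) `|` curve (X i3),
          frontier (Om i2) = curve (X i1) `|` curve (X i3)
        & frontier (Om i3) = curve (X i1) `|` curve (X i2) `|` frontier Omega]].

(* At every relative interior point of every edge of the polygonal curve X,   *)
(* the normal points from A into B.                                           *)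
Definition normals_from_to {R : realType} (N : nat) (q : nat -> R)
    (X : R -> R * R) (A B : set (R * R)) : Prop :=
  forall j, (j < N)%N -> forall s : R, 0 < s < 1 ->
    let x := X (q j) + s *: edge q X j in
    let n := perp (edge q X j) in
    \forall e \near 0^'+, A (x - e *: n) /\ B (x + e *: n).

Definition oriented_network {R : realType} (N : 'I_3 -> nat)
    (q : 'I_3 -> nat -> R) (X : 'I_3 -> R -> R * R)
    (Om : 'I_3 -> set (R * R)) : Prop :=
  [/\ normals_from_to (N i1) (q i1) (X i1) (Om i2) (Om i3),
      normals_from_to (N i2) (q i2) (X i2) (Om i3) (Om i1)
    & normals_from_to (N i3) (q i3) (X i3) (Om i1) (Om i2)].

Definition bulk_eq {R : realType} (lumped : bool) (Omega : set (R * R))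
    (Th : seq (3.-tuple (R * R))) (N : 'I_3 -> nat) (q : 'I_3 -> nat -> R)
    (tau : R) (X0 X1 omega : 'I_3 -> R -> R * R)
    (W : 'I_3 -> R * R -> R) : Prop :=
  forall phi, SmSigma Omega Th phi ->
    grad_ip Omega W phi -
    \sum_(l <- Lambda) (let: (i, j, k) := l in
      opt_int lumped (N i) (q i) (X0 i) (fun r =>
        interp (N i) (q i)
          (fun s => dot (tau^-1 *: (X1 i s - X0 i s)) (omega i s)) r *
        (phi j (X0 i r) - phi k (X0 i r)))) = 0.

Definition curvature_eq {R : realType} (lumped : bool) (N : 'I_3 -> nat)
    (q : 'I_3 -> nat -> R) (X0 : 'I_3 -> R -> R * R) (kappa : 'I_3 -> R -> R)
    (W : 'I_3 -> R * R -> R) : Prop :=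
  forall xi, Vnet N q xi ->
    \sum_(i < 3) lumped_int (N i) (q i) (X0 i) (fun r => kappa i r * xi i r) -
    \sum_(l <- Lambda) (let: (i, j, k) := l in
      opt_int lumped (N i) (q i) (X0 i) (fun r =>
        (W j (X0 i r) - W k (X0 i r)) * xi i r)) = 0.

Definition force_eq {R : realType} (N : 'I_3 -> nat) (q : 'I_3 -> nat -> R)
    (sigma : 'I_3 -> R) (X0 X1 omega : 'I_3 -> R -> R * R)
    (kappa : 'I_3 -> R -> R) : Prop :=
  forall eta, Vnet2 N q eta ->
    \sum_(i < 3) lumped_int (N i) (q i) (X0 i)
      (fun r => dot (kappa i r *: omega i r) (eta i r)) +
    stiffness sigma X0 X1 eta = 0.

(* Main.v *)
Require Import Defs.
From mathcomp Require Import all_boot all_order all_algebra.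
From mathcomp Require Import all_classical all_reals all_analysis.
From mathcomp Require Import measurable_realfun ring lra.
Import Order.TTheory GRing.Theory Num.Theory.
Import numFieldNormedType.Exports.
Local Open Scope classical_set_scope.
Local Open Scope ring_scope.

(** The scheme moves the vertices linearly in time, so the area swept by a
polygonal curve between two time steps is a bilinear expression which the
time-averaged normals integrate exactly.  The proof has a geometric half and
a discrete half.

Geometric half.  The area under a polygonal curve, [ydx], is the integral of
y dx along it.  An open bounded set whose frontier consists of finitely many
segments, the set lying on the left of each, has area minus the sum of these
integrals ([polygon_area]).  This is proved by slicing with vertical lines:
a generic slice is a subset of the real line whose indicator function jumps
by +1 or -1 at each crossed edge, so its length is a signed sum of
crossing heights ([measure_of_jumps]), and these heights are affine in the
abscissa.  The regions are given with their frontiers and with the side of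
every edge on which they lie, which is what this argument takes as input.
Hence the first two regions have areas [ydx] of curve 3 minus [ydx] of
curve 2 and [ydx] of curve 1 minus [ydx] of curve 3 ([region_areas]).

Discrete half.  By the discrete product rule, [ydx] of a curve changes by
the flux of its displacement through the average of the old and new edges,
up to a term depending only on the endpoints ([ydx_increment]).  The three
curves share their endpoints, so these boundary terms cancel in the
differences above.  Testing the definition of the weighted normal with the
displacement identifies the flux with the lumped product of velocity and
weighted normal ([omega_flux]).  Finally the bulk equation is tested with
constant functions: the Dirichlet term vanishes, and since the interpolated
velocity is affine on each element, the lumped and the exact product with a
constant agree, so the three fluxes are equal ([bulk_eq_flux]).

The third region is the complement in the domain of the first two and of a
null set, and the first two areas are finite, so its area is preserved as
well ([network_area]). *)

Set Implicit Arguments.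
Unset Strict Implicit.

(** * Integrals of piecewise affine functions *)

Lemma integral_affine (R : realType) (lo hi c d : R) : lo < hi ->
  (\int[lebesgue_measure]_(x in `[lo, hi]) (c * x + d)%:E =
   ((hi - lo) * ((c * lo + d) + (c * hi + d)) / 2)%:E)%E.
Proof.
move=> lohi.
have cont (g h : R) : continuous (fun x : R => g * (x * x) + h * x).
  move=> x; apply: cvgD; apply: cvgM; try exact: cvg_cst; try exact: cvg_id.
  by apply: cvgM; exact: cvg_id.
have der : forall z : R,
    is_derive z (1 : R) (fun x : R => c / 2 * (x * x) + d * x) (c * z + d).
  move=> z; apply: is_derive_eq.
  by rewrite /GRing.scale/=; field.
have cf : {within `[lo, hi], continuous (fun x : R => c * x + d)}.
  apply: continuous_subspaceT => z; apply: cvgD; last exact: cvg_cst.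
  by apply: cvgM; [exact: cvg_cst|exact: cvg_id].
have dF : derivable_oo_LRcontinuous (fun x : R => c / 2 * (x * x) + d * x) lo hi.
  split.
  - by move=> z _; apply: ex_derive; exact: der.
  - by apply: cvg_at_right_filter; exact: cont.
  - by apply: cvg_at_left_filter; exact: cont.
have F'f : {in `]lo, hi[, derive1 (fun x : R => c / 2 * (x * x) + d * x) =1
    (fun x => c * x + d)}.
  by move=> z _; rewrite derive1E; apply: derive_val; exact: der.
have ftc := continuous_FTC2 lohi cf dF F'f.
rewrite ftc.
by rewrite -EFinB; congr EFin; field.
Qed.

Lemma integrable_affine_piece (R : realType) (lo hi c d : R) :
  lebesgue_measure.-integrable [set: R]
    (fun x => (\1_`]lo, hi[ x * (c * x + d))%:E).
Proof.
have cont : {within `[lo, hi], continuous (fun x : R => c * x + d)}.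
  apply: continuous_subspaceT => z; apply: cvgD; last exact: cvg_cst.
  by apply: cvgM; [exact: cvg_cst|exact: cvg_id].
have hc := continuous_compact_integrable (@segment_compact _ lo hi) cont.
have h : lebesgue_measure.-integrable `]lo, hi[ (EFin \o (fun x => c * x + d)).
  by apply: integrableS hc => //; exact: subset_itv_oo_cc.
move: h; rewrite integrable_mkcond//; apply: eq_integrable => // x _.
rewrite patchE indicE; case: (x \in _); by rewrite ?mul1r ?mul0r.
Qed.

Lemma integral_affine_piece (R : realType) (lo hi c d : R) : lo <= hi ->
  (\int[lebesgue_measure]_x (\1_`]lo, hi[ x * (c * x + d))%:E =
   ((hi - lo) * ((c * lo + d) + (c * hi + d)) / 2)%:E)%E.
Proof.
rewrite le_eqVlt => /predU1P[<-|lohi].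
  rewrite subrr !mul0r integral0_eq// => x _.
  by rewrite indicE set_itvoo0 in_set0 mul0r.
rewrite -integral_affine// -integral_itv_obnd_cbnd; last first.
  apply/measurable_EFinP; apply: measurable_funD; last exact: measurable_cst.
  by apply: measurable_funM; [exact: measurable_cst|exact: measurable_id].
rewrite -integral_itv_bndo_bndc; last first.
  apply/measurable_EFinP; apply: measurable_funD; last exact: measurable_cst.
  by apply: measurable_funM; [exact: measurable_cst|exact: measurable_id].
rewrite [RHS]integral_mkcond; apply: eq_integral => x _.
rewrite patchE indicE; case: (x \in _); by rewrite ?mul1r ?mul0r.
Qed.

(** The pieces are allowed to overlap and the identity may fail at finitely
many points, which is the common form of a polygonal slice length, of the
function giving slice lengths, and of an integrand on a polygonal curve: one
trapezoidal formula then serves all three.  The exceptional values are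
absorbed by indicator functions of points, so that [f] is an exact finite sum
of integrable functions and no separate measurability argument arises. *)
Lemma integral_affine_pieces (R : realType) (I : finType) (lo hi c d : I -> R)
    (S : seq R) (f : R -> R) :
  (forall i, lo i <= hi i) ->
  (forall x, x \notin S ->
     f x = \sum_i \1_`]lo i, hi i[ x * (c i * x + d i)) ->
  lebesgue_measure.-integrable [set: R] (EFin \o f) /\
  (\int[lebesgue_measure]_x (f x)%:E =
   (\sum_i (hi i - lo i) * ((c i * lo i + d i) + (c i * hi i + d i)) / 2)%:E)%E.
Proof.
move=> lohi fE.
pose g x := \sum_i \1_`]lo i, hi i[ x * (c i * x + d i).
have fE' x : (f x)%:E = (\sum_i (\1_`]lo i, hi i[ x * (c i * x + d i))%:E +
    \sum_(s <- undup S) ((f s - g s) * \1_[set s] x)%:E)%E.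
  rewrite !sumEFin -EFinD; congr EFin.
  have [xS|xS] := boolP (x \in S); last first.
    rewrite fE// [X in _ = _ + X]big1_seq ?addr0// => s /=; rewrite mem_undup => sS.
    rewrite indicE memNset ?mulr0// => /= xs; by rewrite xs sS in xS.
  rewrite [X in _ = _ + X](bigD1_seq x) ?mem_undup ?undup_uniq//=.
  rewrite [X in _ = _ + (_ + X)]big1 ?addr0 => [|s sx].
    by rewrite indicE mem_set// mulr1 addrC subrK.
  by rewrite indicE memNset ?mulr0// => /= xs; rewrite xs eqxx in sx.
have int1 s : lebesgue_measure.-integrable [set: R]
    (fun x => ((f s - g s) * \1_[set s] x)%:E).
  have h1 := integrable_indic_itv s s true false.
  rewrite set_itv1 in h1.
  have h2 := integrableZl measurableT (f s - g s) h1.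
  exact: h2.
have fE2 : EFin \o f = (fun x =>
    \sum_i (\1_`]lo i, hi i[ x * (c i * x + d i))%:E +
    \sum_(s <- undup S) ((f s - g s) * \1_[set s] x)%:E)%E.
  exact/funext.
rewrite -[X in (\int[_]_(x in _) X x)%E]/(EFin \o f) fE2.
split.
  apply: integrableD; first exact: measurableT.
    apply: integrable_sum; first exact: measurableT.
    by move=> i _; exact: integrable_affine_piece.
  apply: integrable_sum; first exact: measurableT.
  by move=> s _; exact: int1.
rewrite integralD; first last.
- apply: integrable_sum; first exact: measurableT.
  by move=> s _; exact: int1.
- apply: integrable_sum; first exact: measurableT.
  by move=> i _; exact: integrable_affine_piece.
- exact: measurableT.
rewrite (integral_sum measurableT); last first.
  by move=> i; exact: integrable_affine_piece.
rewrite (integral_sum measurableT int1).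
rewrite [X in (_ + X)%E]big1 ?adde0 => [|s _].
  rewrite -sumEFin; apply: eq_bigr => i _; exact: integral_affine_piece.
under eq_integral do rewrite EFinM.
have h1 := integrable_indic_itv s s true false.
rewrite set_itv1 in h1.
have h2 := integralZl measurableT h1 (f s - g s).
rewrite h2.
rewrite integral_indic; [|exact: measurableT|exact: measurable_set1].
by rewrite setIT; apply: (etrans (congr1 _ (lebesgue_measure_set1 s))); rewrite mule0.
Qed.

(** * Length of a set of reals with finitely many jumps *)

Lemma near_lt_stable (R : realType) (y x : R) : y != x ->
  \forall z \near x, (y < z) = (y < x).
Proof.
case: ltgtP => // yx _.
- by near=> z; near: z; exact: lt_nbhsr.
- near=> z; apply/negbTE; rewrite -leNgt ltW//; near: z; exact: lt_nbhsl.
Unshelve. all: end_near. Qed.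

Lemma near_neq (R : realType) (y x : R) : y != x ->
  \forall z \near x, z != y.
Proof.
case: ltgtP => // yx _.
- by near=> z; rewrite gt_eqF//; near: z; exact: lt_nbhsr.
- by near=> z; rewrite lt_eqF//; near: z; exact: lt_nbhsl.
Unshelve. all: end_near. Qed.

Lemma punctured_open (R : realType) (P : R -> Prop) :
  open [set x : R | \forall y \near x, y != x -> P y].
Proof.
rewrite openE => x /= Hx; have := near_join Hx; apply: filterS => z Hz.
have [->//|zx] := eqVneq z x.
have xz := near_neq (_ : x != z).
rewrite eq_sym zx in xz.
by apply: filterS2 Hz (xz isT) => y Py yx _; exact: Py.
Qed.

(** The set of points near which [f] is zero off the point itself is open, and
so is its complement by local constancy; the line being connected, one such
point forces all of them. *)
Lemma punctured_const_eq0 (R : realType) (f : R -> R) (x0 : R) :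
  (forall x, exists k, \forall y \near x, y != x -> f y = k) ->
  (\forall y \near x0, y != x0 -> f y = 0) ->
  forall x, \forall y \near x, y != x -> f y = 0.
Proof.
move=> fk f0.
pose Z := [set x : R | \forall y \near x, y != x -> f y = 0].
suff ZT : Z = [set: R] by move=> x; have : Z x by rewrite ZT.
have cT : connected [set: R] by apply/connected_intervalP => ? ? *.
apply: cT.
- by exists x0.
- by exists Z; [exact: punctured_open|rewrite setTI].
- exists Z; last by rewrite setTI.
  rewrite -[Z]setCK closedC.
  have -> : ~` Z = [set x : R | \forall y \near x, y != x -> f y != 0].
    apply/seteqP; split => x /=.
      move=> nZ; have [k Hk] := fk x.
      have Hk0 := Hk; apply: filterS Hk => y Hk yx; rewrite Hk//.
      apply/eqP => k0; apply: nZ; rewrite /Z/= -k0.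
      exact: Hk0.
    move=> H1 H2.
    have F : x^' (fun=> False).
      apply: filterS2 H1 H2 => y h1 h2 yx.
      by move: (h1 yx); rewrite h2// eqxx.
    by have [] := filter_ex F.
  exact: punctured_open.
Qed.

(** The indicator function of [U] and the step function jumping by [c i] at
[y i] have the same jumps, and both vanish far to the left, so they agree off
the jump points.  Boundedness of [U] then makes the total jump zero, and
integrating the step function up to a common right end gives the formula.
Indices with [c i = 0] stand for edges that the slice does not cross. *)
Lemma measure_of_jumps (R : realType) (I : finType) (y c : I -> R) (U : set R)
    (M : R) :
  measurable U -> (forall z, U z -> `|z| < M) ->
  (forall z, (forall i, c i != 0 -> y i != z) -> \forall w \near z, U w <-> U z) ->
  (forall i k, c i != 0 -> c k != 0 -> y i = y k -> i = k) ->
  (forall i, c i != 0 -> exists u : R,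
     (\forall w \near y i, w < y i -> \1_U w = u) /\
     (\forall w \near y i, y i < w -> \1_U w = u + c i)) ->
  lebesgue_measure U = (- \sum_i c i * y i)%:E.
Proof.
move=> mU UM Uconst yinj Ujump.
pose F (z : R) : R := \sum_i c i * (y i < z)%R%:R.
have Fnear z : \forall w \near z, forall i, y i != z -> (y i < w) = (y i < z).
  pose P i (w : R) := y i != z -> (y i < w) = (y i < z).
  have H i : \forall w \near z, P i w.
    have [yz|yz] := eqVneq (y i) z; last first.
      by apply: filterS (near_lt_stable yz) => w wE _.
    by apply: (@filterS _ (nbhs z) _ setT); [move=> w _; rewrite /P yz eqxx|exact: filterT].
  exact: (@filter_forall _ _ P (nbhs z) _ H).
have Gfull z : (forall i, c i != 0 -> y i != z) ->
    \forall w \near z, \1_U w - F w = \1_U z - F z.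
  move=> cz; near=> w; congr (_ - _).
    rewrite !indicE; congr (_ %:R); congr (nat_of_bool _).
    have : U w <-> U z by near: w; exact: Uconst.
    by move=> UU; apply/idP/idP => /set_mem H; apply/mem_set/UU.
  apply: eq_bigr => i _; have [->|ci] := eqVneq (c i) 0.
    by rewrite !mul0r.
  congr (_ * _%:R); congr (nat_of_bool _).
  have := cz i ci; move: i {ci}; near: w.
  exact: Fnear.
have Gconst : forall z, exists k, \forall w \near z, w != z -> \1_U w - F w = k.
  move=> z.
  have [/existsP[k /andP[ck /eqP yk]]|/existsPn nex] :=
    boolP [exists k, (c k != 0) && (y k == z)].
    have [u [ul ur]] := Ujump k ck; rewrite yk in ul ur.
    exists (u - \sum_(i | i != k) c i * (y i < z)%R%:R).
    have FE w : (forall i, y i != z -> (y i < w) = (y i < z)) ->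
        F w = c k * (z < w)%R%:R + \sum_(i | i != k) c i * (y i < z)%R%:R.
      move=> Hw; rewrite /F (bigD1 k)//= yk; congr (_ + _).
      apply: eq_bigr => i ik; have [->|ci] := eqVneq (c i) 0.
        by rewrite !mul0r.
      rewrite Hw//; apply: contra ik => /eqP yi.
      by apply/eqP/yinj => //; rewrite yi.
    near=> w => wz.
    rewrite FE; last by near: w; exact: Fnear.
    have L : w < z -> \1_U w = u by near: w; exact: ul.
    have wR : z < w -> \1_U w = u + c k by near: w; exact: ur.
    move: wz; case: ltgtP L wR => // wz L wR _.
    - by rewrite L// mulr0 add0r.
    - by rewrite wR// mulr1 opprD addrA addrK.
  have cz i : c i != 0 -> y i != z.
    by move=> ci; have := nex i; rewrite ci.
  exists (\1_U z - F z); apply: filterS (Gfull z cz) => w H _; exact: H.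
pose Y := \sum_i `|y i|.
have Yy i : `|y i| <= Y by rewrite /Y (bigD1 i)//= lerDl sumr_ge0.
have Y0 : 0 <= Y by rewrite sumr_ge0.
have M0 := normr_ge0 M.
have MM := ler_norm M.
(* One unit beyond M' - 1, itself beyond U and beyond all jump points, so that
   the total jump can be read off strictly inside the range. *)
pose M' := `|M| + Y + 2.
have U0 z : `|M| <= `|z| -> \1_U z = 0 :> R.
  move=> Mz; rewrite indicE memNset// => /UM; lra.
have yleY i := ler_normlW (Yy i).
have yge i : - Y <= y i by have := Yy i; rewrite ler_norml => /andP[].
have G0 := punctured_const_eq0 (x0 := - M') Gconst.
have {}G0 : forall z, \forall w \near z, w != z -> \1_U w - F w = 0.
  apply: G0; near=> w => _.
  have wM : w < - (M' - 1).
    by near: w; apply: lt_nbhsl; lra.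
  rewrite /M' in wM.
  rewrite U0 ?sub0r; last by rewrite (ler0_norm (x := w)); lra.
  apply/eqP; rewrite oppr_eq0; apply/eqP; apply: big1 => i _.
  have := yge i; move=> yg; rewrite ltNge.
  by rewrite (_ : w <= y i) ?mulr0//; lra.
have UF z : (forall i, c i != 0 -> y i != z) -> \1_U z = F z :> R.
  move=> cz; apply/eqP; rewrite -subr_eq0; apply/eqP.
  have H : z^' (fun w => \1_U w - F w = \1_U z - F z).
    apply: filterS (Gfull z cz) => w H _; exact: H.
  by have [w [<-]] := filter_ex (filterI H (G0 z)).
have sc : \sum_i c i = 0.
  have yz i : y i < M' - 1 by rewrite /M'; have := yleY i; lra.
  have H : F (M' - 1) = 0.
    rewrite -UF; last by move=> i _; rewrite lt_eqF.
    by apply: U0; rewrite (ger0_norm (x := M' - 1)) /M'; lra.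
  by rewrite -[RHS]H; apply: eq_bigr => i _; rewrite yz mulr1.
have yM' i : y i <= M' by rewrite /M'; have := yleY i; lra.
have [|_] := @integral_affine_pieces R I y (fun=> M') (fun=> 0) c
  (M' :: [seq y i | i : I]) \1_U yM'.
  move=> z; rewrite in_cons negb_or => /andP[zM /mapP ny].
  move: zM; case: ltgtP => // zM _.
    rewrite UF; last first.
      by move=> i _; apply/eqP => yi; apply: ny; exists i; rewrite ?mem_enum.
    apply: eq_bigr => i _; rewrite mul0r add0r mulrC indicE; congr (_ %:R * _).
    by rewrite mem_setE in_itv/= zM andbT.
  rewrite U0; last by rewrite (ger0_norm (x := z)); move: zM; rewrite /M'; lra.
  rewrite big1// => i _.
  by rewrite indicE mem_setE in_itv/= (ltNge z) (ltW zM) andbF mul0r.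
rewrite integral_indic; [|exact: measurableT|exact: mU].
rewrite setIT => ->; congr EFin.
transitivity (M' * (\sum_i c i) - \sum_i c i * y i).
  by rewrite mulr_sumr -sumrB; apply: eq_bigr => i _; field.
by rewrite sc mulr0 sub0r.
Unshelve. all: end_near. Qed.

(** * Area of a polygonal region *)

Definition segment_point (R : realType) (a b : R * R) (s : R) : R * R :=
  a + s *: (b - a).

Lemma segment_pointE (R : realType) (a b : R * R) (s : R) :
  segment_point a b s = (a.1 + s * (b.1 - a.1), a.2 + s * (b.2 - a.2)).
Proof. by []. Qed.

Lemma continuous_segment_point (R : realType) (a b : R * R) :
  continuous (segment_point a b).
Proof.
move=> s; apply: cvgD; first exact: cvg_cst.
by apply: cvgZl; exact: cvg_id.
Qed.

Lemma near_all (T : topologicalType) (x : T) (P : T -> Prop) :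
  (forall z, P z) -> \forall z \near x, P z.
Proof. by move=> HP; apply: (@filterS _ (nbhs x) _ setT); last exact: filterT. Qed.

Lemma near_forall (T : topologicalType) (I : finType) (x : T)
    (P : I -> T -> Prop) :
  (forall i, \forall z \near x, P i z) -> \forall z \near x, forall i, P i z.
Proof. exact: filter_forall. Qed.

(** Off the frontier [A] coincides with its closure, hence the parameters of
the points in [A] form a clopen part of a segment. *)
Lemma segment_off_frontier (R : realType) (A : set (R * R)) (u w : R * R) :
  open A ->
  (forall s, 0 <= s <= 1 -> ~ frontier A (segment_point u w s)) -> A u -> A w.
Proof.
move=> oA nfr Au; pose g := segment_point u w.
have g0 : g 0 = u by rewrite /g /segment_point scale0r addr0.
have g1 : g 1 = w by rewrite /g /segment_point scale1r addrC subrK.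
have cg : continuous g by exact: continuous_segment_point.
pose B : set R := `[0, 1] `&` (g @^-1` A).
have BT : B = `[0, 1]%classic.
  apply: (segment_connected (B := B)).
  - by exists 0; split; rewrite /= ?in_itv/= ?lexx ?ler01// g0.
  - by exists (g @^-1` A) => //; apply: open_comp => // ? _; exact: cg.
  - exists (g @^-1` closure A).
      by apply: closed_comp; [move=> ? _; exact: cg|exact: closed_closure].
    apply/seteqP; split=> s /= [s01 gs]; split => //.
      exact: subset_closure.
    move: s01; rewrite /= in_itv/= => s01.
    apply: contrapT => nA; apply: (nfr s s01); split => //.
    by move: oA; rewrite openE => oA /interior_subset.
have : B 1 by rewrite BT /= in_itv/= lexx ler01.
by case=> _ /=; rewrite /preimage/= g1.
Qed.

Lemma closed_segment (R : realType) (a b : R * R) :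
  closed [set segment_point a b s | s in `[0, 1]].
Proof.
apply: compact_closed; first exact: norm_hausdorff.
apply: continuous_compact; last exact: segment_compact.
by apply: continuous_subspaceT; exact: continuous_segment_point.
Qed.

(** Open sets are countable unions of boxes with rational center and radius. *)
Lemma open_measurable_plane (R : realType) (A : set (R * R)) : open A ->
  measurable (A : set (measurableTypeR R * measurableTypeR R)).
Proof.
move=> oA.
pose box (k : rat * rat * rat) : set (R * R) :=
  `](ratr k.1.1 - ratr k.2), (ratr k.1.1 + ratr k.2)[ `*`
  `](ratr k.1.2 - ratr k.2), (ratr k.1.2 + ratr k.2)[.
have -> : A = \bigcup_(k : rat * rat * rat) (if `[<box k `<=` A>] then box k else set0).
  apply/seteqP; split=> [z Az|z [k _]]; last by case: asboolP => // kA; exact: kA.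
  have /nbhs_ballP[e /= e0 eA] : nbhs z A by move: oA; rewrite openE => /(_ _ Az).
  have e2 : 0 < e / 2 by lra.
  have [r] := rat_in_itvoo e2; rewrite in_itv/= => /andP[r0 re].
  have near_rat (y : R) : exists c : rat, y - ratr r < ratr c < y + ratr r.
    have yr : y - ratr r < y + ratr r by lra.
    by have [c] := rat_in_itvoo yr; rewrite in_itv/=; exists c.
  have [[a /andP[a1 a2]] [b /andP[b1 b2]]] := (near_rat z.1, near_rat z.2).
  exists (a, b, r) => //; rewrite ifT.
    by rewrite /box; split; rewrite /= in_itv/=; apply/andP; split; lra.
  apply/asboolP => w; rewrite /box => -[/=].
  rewrite !in_itv/= => /andP[w1 w2] /andP[w3 w4].
  by apply: eA; split; rewrite /ball/= ltr_norml; apply/andP; split; lra.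
apply: countable_bigcupT_measurable; first exact: countableP.
move=> k; case: asboolP => _; last exact: measurable0.
by apply: measurableX; exact: measurable_itv.
Qed.

Lemma convex_lt (R : realType) (a b r s : R) : 0 <= s <= 1 -> a < r -> b < r ->
  a + s * (b - a) < r.
Proof.
move=> /andP[s0 s1] ar br.
have rb : 0 < r - b by rewrite subr_gt0.
have ra : 0 < r - a by rewrite subr_gt0.
have h1 : 0 <= s * (r - b) by rewrite mulr_ge0// ltW.
have [->|s1'] := eqVneq s 1; first by rewrite mul1r addrC subrK.
have h2 : 0 < (1 - s) * (r - a) by rewrite mulr_gt0// subr_gt0 lt_neqAle s1'.
lra.
Qed.

(** A ball for the max norm is a box, hence half of it cut by a line is convex;
if the frontier meets the ball only on that line, then [A] contains all or none
of the open half. *)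
Lemma half_box_stable (R : realType) (A : set (R * R)) (p n u w : R * R) (r : R) :
  open A ->
  (forall z, ball p r z -> frontier A z -> dot (z - p) n = 0) ->
  ball p r u -> ball p r w -> 0 < dot (u - p) n -> 0 < dot (w - p) n -> A u -> A w.
Proof.
move=> oA frA [u1 u2] [w1 w2] un wn; apply: segment_off_frontier => // s s01 fr.
have : dot (segment_point u w s - p) n = 0.
  apply: frA fr; move: u1 u2 w1 w2; rewrite /ball/= !ltr_norml.
  move=> /andP[? ?] /andP[? ?] /andP[? ?] /andP[? ?].
  have c1 : (p.1 - u.1) + s * ((p.1 - w.1) - (p.1 - u.1)) < r by apply: convex_lt => //; lra.
  have c2 : (p.2 - u.2) + s * ((p.2 - w.2) - (p.2 - u.2)) < r by apply: convex_lt => //; lra.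
  have c3 : (u.1 - p.1) + s * ((w.1 - p.1) - (u.1 - p.1)) < r by apply: convex_lt => //; lra.
  have c4 : (u.2 - p.2) + s * ((w.2 - p.2) - (u.2 - p.2)) < r by apply: convex_lt => //; lra.
  rewrite segment_pointE; split; rewrite /ball/= ltr_norml; apply/andP; split; lra.
rewrite -oppr_lt0 in un; rewrite -oppr_lt0 in wn.
have := convex_lt s01 un wn.
by rewrite segment_pointE /dot/=; lra.
Qed.

(** The hypothesis on normals only controls the line through [p] along [n], with
no uniformity in [p].  Since the frontier is straight near [p], it extends to
both open halves of a neighborhood, which makes it usable along the vertical
direction. *)
Lemma edge_sides (R : realType) (A : set (R * R)) (p n : R * R) :
  open A ->
  (\forall z \near p, frontier A z -> dot (z - p) n = 0) ->
  (\forall e \near 0^'+, ~ A (p - e *: n) /\ A (p + e *: n)) ->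
  \forall z \near p, (0 < dot (z - p) n -> A z) /\ (dot (z - p) n < 0 -> ~ A z).
Proof.
move=> oA /nbhs_ballP[r /= r0 frA] sides.
have [n0|n0] := eqVneq (dot n n) 0.
  have [n1 n2] : n.1 = 0 /\ n.2 = 0 by move: n0; rewrite /dot; split; nra.
  by apply: near_all => z; rewrite /dot n1 n2 !mulr0 addr0 ltxx.
have nn : 0 < dot n n by rewrite lt_neqAle eq_sym n0 /dot; nra.
have [e [[nAe Ae] [e0 [eb1 eb2]]]] : exists e : R,
    (~ A (p - e *: n) /\ A (p + e *: n)) /\
    (0 < e /\ ball p r (p - e *: n) /\ ball p r (p + e *: n)).
  have cb (n' : R * R) : \forall e \near (0 : R)^'+, ball p r (p + e *: n').
    have nb : nbhs (segment_point p (p + n') 0) (ball p r).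
      by rewrite /segment_point scale0r addr0; exact: nbhsx_ballx.
    have H : nbhs (0 : R) (fun e => ball p r (segment_point p (p + n') e)).
      exact: continuous_segment_point p (p + n') 0 _ nb.
    have {}H : \forall e \near (0 : R), ball p r (p + e *: n').
      by apply: filterS H => e; rewrite /segment_point (addrC p n') addrK.
    exact: cvg_within H.
  have c1 : \forall e \near (0 : R)^'+, ball p r (p - e *: n).
    by apply: filterS (cb (- n)) => e; rewrite scalerN.
  have c2 := cb n.
  apply: (@filter_ex _ (0 : R)^'+).
  near=> e; split; first by near: e.
  by split; [near: e; exact: nbhs_right_gt|split; near: e].
have dE c : dot (p + c *: n - p) n = c * dot n n.
  by rewrite addrC addKr /dot/= -!mulrA -mulrDr.
have {}frA z : ball p r z -> frontier A z -> dot (z - p) n = 0.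
  by move=> /frA; apply.
near=> z.
have bz : ball p r z by near: z; exact: nbhsx_ballx.
split=> zn.
  apply: (half_box_stable oA frA eb2 bz) => //.
  by rewrite dE mulr_gt0.
move=> Az; apply: nAe.
apply: (half_box_stable (n := - n) (p := p) (r := r) (u := z) oA _ bz) => //.
- by move=> y ball_y fry; have := frA _ ball_y fry; rewrite /dot/=; lra.
- by move: zn; rewrite /dot/=; lra.
- have := dE (- e); rewrite scaleNr => H; have := mulr_gt0 e0 nn.
  by move: H; rewrite /dot/=; lra.
Unshelve. all: end_near. Qed.

Section polygon.
Variables (R : realType) (I : finType) (a b : I -> R * R) (A : set (R * R)) (M : R).
Hypothesis oA : open A.
Hypothesis AM : forall z, A z -> `|z.1| < M /\ `|z.2| < M.
Hypothesis frA : forall z, frontier A z ->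
  exists i, exists2 s : R, 0 <= s <= 1 & z = segment_point (a i) (b i) s.
Hypothesis simp : forall i k (s t : R), 0 < s < 1 -> 0 <= t <= 1 ->
  segment_point (a i) (b i) s = segment_point (a k) (b k) t -> i = k.
Hypothesis inw : forall i (s : R), 0 < s < 1 ->
  \forall e \near 0^'+, 
    ~ A (segment_point (a i) (b i) s - e *: perp (b i - a i)) /\
    A (segment_point (a i) (b i) s + e *: perp (b i - a i)).

(** The other segments are closed and avoid the given point, so a neighborhood
of it meets the frontier only in the segment that contains it. *)
Lemma polygon_edge_sides k (s : R) : 0 < s < 1 ->
  let p := segment_point (a k) (b k) s in
  let n := perp (b k - a k) in
  \forall z \near p, (0 < dot (z - p) n -> A z) /\ (dot (z - p) n < 0 -> ~ A z).
Proof.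
move=> s01 p n; apply: edge_sides => //; last exact: inw.
pose P i (z : R * R) := i != k ->
  ~ [set segment_point (a i) (b i) t | t in `[0, 1]] z.
have H i : \forall z \near p, P i z.
  have [ik|ik] := eqVneq i k.
    by apply: near_all => z; rewrite /P ik eqxx.
  have : nbhs p (~` [set segment_point (a i) (b i) t | t in `[0, 1]]).
    apply: open_nbhs_nbhs; split; first exact/closed_openC/closed_segment.
    move=> [t /=]; rewrite in_itv/= => t01 pt.
    have := simp s01 t01 (esym pt).
    by move=> ki; rewrite ki eqxx in ik.
  by apply: filterS => z nz _.
have HP : nbhs p (fun z => forall i, P i z).
  exact: (near_forall H).
apply: filterS HP => z Pz /frA[i [t t01 zE]].
have [ik|ik] := eqVneq i k; last first.
  by case: (Pz i ik); exists t => //=; rewrite in_itv.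
rewrite zE ik /dot /n /p !segment_pointE /perp/=; ring.
Qed.


(** A vertical line through no vertex crosses each edge at most once, in its
relative interior, and enters [A] upwards when the edge runs to the right. *)
Lemma polygon_slice (x : R) :
  (forall i, (a i).1 != x) -> (forall i, (b i).1 != x) ->
  let lo i := Num.min (a i).1 (b i).1 in
  let hi i := Num.max (a i).1 (b i).1 in
  let y i := (a i).2 + (x - (a i).1) / ((b i).1 - (a i).1) * ((b i).2 - (a i).2) in
  lebesgue_measure [set z | A (x, z)] =
  (- \sum_i \1_`]lo i, hi i[ x * Num.sg ((b i).1 - (a i).1) * y i)%:E.
Proof.
move=> ax bx lo hi y.
pose c i := \1_`]lo i, hi i[ x * Num.sg ((b i).1 - (a i).1).
have cross i : c i != 0 ->
    exists s : R, [/\ 0 < s < 1, segment_point (a i) (b i) s = (x, y i)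
      & (b i).1 - (a i).1 != 0 /\ c i = Num.sg ((b i).1 - (a i).1)].
  rewrite /c indicE; case: (boolP (x \in _)) => [|_]; last by rewrite mul0r eqxx.
  rewrite mul1r sgr_eq0 mem_setE in_itv/= /lo /hi => + ab.
  rewrite gt_min lt_max => xab.
  exists ((x - (a i).1) / ((b i).1 - (a i).1)); split => //; last first.
    by rewrite segment_pointE /y; congr (_, _); field.
  have [ab'|ab'|ab'] := ltgtP (a i).1 (b i).1; last first.
  - by rewrite ab' subrr eqxx in ab.
  - have xb : (b i).1 < x < (a i).1.
      by apply/andP; move: xab => /andP[/orP[?|?] /orP[?|?]]; split; lra.
    rewrite -mulrNN -invrN !opprB divr_gt0 ?ltr_pdivrMr ?subr_gt0; lra.
  - have xb : (a i).1 < x < (b i).1.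
      by apply/andP; move: xab => /andP[/orP[?|?] /orP[?|?]]; split; lra.
    rewrite divr_gt0 ?ltr_pdivrMr ?subr_gt0; lra.
have cross_fr (z : R) : frontier A (x, z) -> exists2 i, c i != 0 & y i = z.
  move=> /frA[i [s /andP[s0 s1]]]; rewrite segment_pointE => -[xE zE].
  have ab : (b i).1 - (a i).1 != 0.
    by apply/eqP => ab0; move: (ax i); rewrite xE ab0 mulr0 addr0 eqxx.
  have sE : s = (x - (a i).1) / ((b i).1 - (a i).1).
    by rewrite {1}xE; field.
  have s0' : 0 < s.
    rewrite lt_neqAle s0 andbT; apply/eqP => s00; move: (ax i).
    by rewrite xE -s00 mul0r addr0 eqxx.
  have s1' : s < 1.
    rewrite lt_neqAle s1 andbT; apply/eqP => s11; move: (bx i).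
    by rewrite xE s11 mul1r addrC subrK eqxx.
  exists i; last by rewrite /y -sE zE.
  rewrite /c mulf_neq0// ?sgr_eq0// indicE mem_set ?oner_eq0//=.
  rewrite in_itv/= /lo /hi gt_min lt_max.
  have s1'' : 0 < 1 - s by rewrite subr_gt0.
  case: (ltgtP ((b i).1 - (a i).1) 0) ab => // ab _.
  - have h1 : 0 < s * ((a i).1 - (b i).1) by rewrite mulr_gt0//; lra.
    have h2 : 0 < (1 - s) * ((a i).1 - (b i).1) by rewrite mulr_gt0//; lra.
    by apply/andP; split; apply/orP; [right|left]; lra.
  - have h1 : 0 < s * ((b i).1 - (a i).1) by rewrite mulr_gt0.
    have h2 : 0 < (1 - s) * ((b i).1 - (a i).1) by rewrite mulr_gt0.
    by apply/andP; split; apply/orP; [left|right]; lra.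
have slice_cont : continuous (fun z : R => (x, z)).
  rewrite (_ : (fun z => (x, z)) = segment_point (x, 0) (x, 1)).
    exact: continuous_segment_point.
  by apply/funext => z; rewrite segment_pointE/=; congr (_, _); ring.
have slice_near (z : R) (P : R * R -> Prop) : nbhs (x, z) P -> \forall w \near z, P (x, w).
  exact: slice_cont.
rewrite (@measure_of_jumps R I y c _ M).
- by congr (- _)%:E; apply: eq_bigr => i _.
- apply: open_measurable; apply: open_comp => // z _; exact: slice_cont.
- by move=> z /AM[].
- move=> z nc.
  have [Az|nAz] := pselect (A (x, z)).
    have : nbhs (x, z) A by apply: open_nbhs_nbhs.
    move=> /slice_near; apply: filterS => w Aw; split => //.
  have : nbhs (x, z) (~` closure A).
    apply: open_nbhs_nbhs; split; first exact/closed_openC/closed_closure.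
    move=> clA; have [|i ci yz] := cross_fr z; last first.
      by have := nc i ci; rewrite yz eqxx.
    by split => // /interior_subset.
  move=> /slice_near; apply: filterS => w nAw; split => // Aw.
  by exfalso; apply: nAw; exact: subset_closure.
- move=> i k ci ck yik.
  have [s [s01 sE _]] := cross i ci; have [t [t01 tE _]] := cross k ck.
  apply: (simp (s := s) (t := t)) => //; last by rewrite sE tE yik.
  by case/andP: t01 => /ltW -> /ltW ->.
- move=> i ci; have [s [s01 sE [ab cE]]] := cross i ci.
  have := polygon_edge_sides i s01; rewrite /= sE => /slice_near H.
  have dE w : dot ((x, w) - (x, y i)) (perp (b i - a i)) =
     (w - y i) * ((b i).1 - (a i).1).
    by rewrite /dot /perp /=; ring.
  have {}H : \forall w \near y i, 
      (0 < (w - y i) * ((b i).1 - (a i).1) -> A (x, w)) /\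
      ((w - y i) * ((b i).1 - (a i).1) < 0 -> ~ A (x, w)).
    by apply: filterS H => w; rewrite /= dE.
  rewrite cE; case: ltgtP ab => // ab _.
  + exists 1; split; apply: filterS H => w [H1 H2] wy; rewrite indicE.
    * by rewrite mem_set//; apply: H1; rewrite nmulr_lgt0// subr_lt0.
    * rewrite memNset ?ltr0_sg ?subrr//; apply: H2.
      by rewrite nmulr_llt0// subr_gt0.
  + exists 0; split; apply: filterS H => w [H1 H2] wy; rewrite indicE.
    * by rewrite memNset//; apply: H2; rewrite pmulr_llt0// subr_lt0.
    * rewrite mem_set ?gtr0_sg ?add0r//; apply: H1.
      by rewrite pmulr_lgt0// subr_gt0.
Qed.

(** The slice lengths of [polygon_slice] are affine in the abscissa on the
projection of each edge.  The signs are those of counterclockwise boundaries,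
with [A] on the left of every edge. *)
Lemma polygon_area :
  area A = (- \sum_i ((b i).1 - (a i).1) * ((a i).2 + (b i).2) / 2)%:E.
Proof.
pose mu := @lebesgue_measure R.
pose lo i := Num.min (a i).1 (b i).1.
pose hi i := Num.max (a i).1 (b i).1.
pose sl i := ((b i).2 - (a i).2) / ((b i).1 - (a i).1).
pose sg i := Num.sg ((b i).1 - (a i).1).
have lohi i : lo i <= hi i by rewrite /lo /hi ge_min le_max lexx.
have secE x : xsection A x = [set z | A (x, z)].
  by apply/seteqP; split=> z; rewrite /xsection/= inE.
have mA : measurable (A : set (measurableTypeR R * measurableTypeR R)).
  exact: open_measurable_plane.
(* Slices through a vertex are not described by polygon_slice; their lengths
   only have to be finite. *)
have fin x : mu (xsection A x) \is a fin_num.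
  rewrite ge0_fin_numE//; apply: (@le_lt_trans _ _ (mu `[- M, M]%classic)).
    apply: le_measure; rewrite ?inE//; first exact: measurable_xsection.
    move=> z; rewrite secE /= in_itv/= => /AM[_] /=.
    by rewrite ltr_norml => /andP[/ltW -> /ltW ->].
  by rewrite /mu lebesgue_measure_itv/=; case: ifP => // _; rewrite -EFinB ltry.
have [|_ intE] := @integral_affine_pieces R I lo hi (fun i => - (sg i * sl i))
  (fun i => - (sg i * ((a i).2 - (a i).1 * sl i)))
  ([seq (a i).1 | i : I] ++ [seq (b i).1 | i : I])
  (fun x => fine (mu (xsection A x))) lohi.
  move=> x; rewrite mem_cat negb_or => /andP[xa xb].
  rewrite secE /mu polygon_slice/=; last first.
  - by move=> i; apply: contra xb => /eqP <-; apply: map_f; rewrite mem_enum.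
  - by move=> i; apply: contra xa => /eqP <-; apply: map_f; rewrite mem_enum.
  rewrite -sumrN; apply: eq_bigr => i _.
  rewrite -mulrA -mulrN; congr (_ * _).
  by rewrite /sl -/(sg i); ring.
rewrite /area /product_measure1/=.
transitivity (\int[mu]_x (fine (mu (xsection A x)))%:E)%E.
  by apply: eq_integral => x _; rewrite (fineK (fin x)).
rewrite intE; congr EFin; rewrite -sumrN; apply: eq_bigr => i _.
rewrite /lo /hi /sg /sl; case: (ltgtP (a i).1 (b i).1) => ab.
- rewrite gtr0_sg ?subr_gt0//; field.
  by rewrite subr_eq0 gt_eqF.
- rewrite ltr0_sg ?subr_lt0//; field.
  by rewrite subr_eq0 lt_eqF.
- by rewrite ab !subrr !mul0r oppr0.
Qed.

End polygon.

(** * Polygonal curves and the regions between them *)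

Lemma measurable_segment (R : realType) (a b : R * R) :
  measurable ([set segment_point a b s | s in `[0, 1]] :
    set (measurableTypeR R * measurableTypeR R)).
Proof.
set S := [set _ | _ in _].
rewrite -[S]setCK; apply: measurableC; apply: open_measurable_plane.
exact/closed_openC/closed_segment.
Qed.

(** A vertical line other than the one through the first endpoint meets the
segment in at most one point. *)
Lemma segment_area0 (R : realType) (a b : R * R) :
  area [set segment_point a b s | s in `[0, 1]] = 0%:E.
Proof.
rewrite /area /product_measure1/=.
set S := [set _ | _ in _].
have xS x : x != a.1 -> lebesgue_measure (xsection S x) = 0%:E.
  move=> xa; have sub : xsection S x `<=` 
      [set a.2 + (x - a.1) / (b.1 - a.1) * (b.2 - a.2)].
    move=> y; rewrite /xsection/= inE => -[s _].
    rewrite segment_pointE => -[xE <-].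
    have ab : b.1 - a.1 != 0.
      by apply: contra xa => /eqP ab; rewrite -xE ab mulr0 addr0.
    by rewrite -xE; field.
  by have [->|->] := subset_set1 sub; rewrite ?measure0 ?lebesgue_measure_set1.
rewrite (ae_eq_integral (cst 0%E)).
- exact: integral0.
- exact: measurableT.
- by apply: measurable_fun_xsection; exact: measurable_segment.
- exact: measurable_cst.
- exists [set a.1]; split.
  + exact: measurable_set1.
  + exact: lebesgue_measure_set1.
  + move=> x /=; apply: contra_notP => /eqP xa _; exact: xS.
Qed.

Section partition.
Variables (R : realType) (N : nat) (q : nat -> R).
Hypothesis hq : I_partition N q.

Lemma partition_lt j : (j < N)%N -> q j < q j.+1.
Proof. by case: hq => _ _ _; apply. Qed.

Lemma partition_le j k : (j <= k)%N -> (k <= N)%N -> q j <= q k.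
Proof.
elim: k => [|k IH]; first by rewrite leqn0 => /eqP ->.
rewrite leq_eqVlt => /predU1P[->//|jk] kN.
by apply: le_trans (IH jk (ltnW kN)) (ltW (partition_lt kN)).
Qed.

Lemma partition_bounds j : (j <= N)%N -> 0 <= q j <= 1.
Proof.
case: (hq) => _ q0 qN _ jN; rewrite -{1}q0 -qN.
by rewrite !partition_le.
Qed.

Lemma partition_locate r : 0 <= r <= 1 ->
  exists2 j, (j < N)%N & q j <= r <= q j.+1.
Proof.
case: (hq) => N2 q0 qN _ /andP[]; rewrite -{1}q0 -qN => q0r.
suff H k : (k <= N)%N -> (0 < k)%N -> r <= q k ->
    exists2 j, (j < N)%N & q j <= r <= q j.+1.
  by apply: H => //; exact: ltn_trans N2.
elim: k => // k IH kN _ rk.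
have [rk'|kr] := ltP r (q k); last by exists k => //; rewrite kr rk.
case: k IH kN rk rk' => [|k] IH kN rk rk'.
  by move: q0r; rewrite leNgt rk'.
by apply: IH => //; [exact: ltnW|exact: ltW].
Qed.

Lemma partition_inj r j k : (j < N)%N -> (k < N)%N ->
  q j < r < q j.+1 -> q k <= r <= q k.+1 -> j = k.
Proof.
move=> jN kN /andP[r1 r2] /andP[r3 r4].
apply/eqP; rewrite eqn_leq; apply/andP; split; rewrite leqNgt; apply/negP => jk.
- have := partition_le jk (ltnW jN).
  by rewrite leNgt (lt_le_trans r1 r4).
- have := partition_le jk (ltnW kN).
  by rewrite leNgt (le_lt_trans r3 r2).
Qed.

Lemma Vh_affine v j r : Vh N q v -> (j < N)%N -> q j <= r <= q j.+1 ->
  v r = v (q j) + (r - q j) / (q j.+1 - q j) * (v (q j.+1) - v (q j)).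
Proof.
move=> [_ /(_ j)]; move=> /[swap] jN /(_ jN) [a [b vE]] rj.
have qj := partition_lt jN.
rewrite !vE ?lexx ?(ltW qj)//; field.
by rewrite subr_eq0 gt_eqF.
Qed.

Lemma Vh2_segment X j s : Vh2 N q X -> (j < N)%N -> 0 <= s <= 1 ->
  X (q j + s * (q j.+1 - q j)) = segment_point (X (q j)) (X (q j.+1)) s.
Proof.
move=> [X1 X2] jN /andP[s0 s1].
have qj := partition_lt jN.
have qq : q j.+1 - q j != 0 by rewrite subr_eq0 gt_eqF.
have rj : q j <= q j + s * (q j.+1 - q j) <= q j.+1.
  rewrite lerDl mulr_ge0 ?subr_ge0 ?(ltW qj)//=.
  by rewrite -lerBrDl ler_piMl// subr_ge0 ltW.
rewrite segment_pointE [LHS]surjective_pairing.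
by rewrite (Vh_affine X1 jN rj) (Vh_affine X2 jN rj)/= (addrC (q j) (s * _)) addrK mulfK.
Qed.

Lemma curve_segments X : Vh2 N q X ->
  curve X = \bigcup_(j in [set j | (j < N)%N])
    [set segment_point (X (q j)) (X (q j.+1)) s | s in `[0, 1]].
Proof.
move=> hX; apply/seteqP; split => z.
  move=> [r /=]; rewrite in_itv/= => r01 <-.
  have [j jN rj] := partition_locate r01.
  have qj := partition_lt jN.
  exists j => //; exists ((r - q j) / (q j.+1 - q j)) => /=.
    rewrite in_itv/=; case/andP: rj => r1 r2.
    by rewrite divr_ge0 ?subr_ge0 ?(ltW qj)//= ler_pdivrMr ?subr_gt0// mul1r lerB.
  rewrite -Vh2_segment//.
    by congr X; field; rewrite subr_eq0 gt_eqF.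
  case/andP: rj => r1 r2.
  by rewrite divr_ge0 ?subr_ge0 ?(ltW qj)//= ler_pdivrMr ?subr_gt0// mul1r lerB.
move=> [j /= jN [s /=]]; rewrite in_itv/= => s01 <-.
rewrite -Vh2_segment//; eexists => //=.
rewrite in_itv/=.
have /andP[a1 _] := partition_bounds (ltnW jN).
have /andP[_ a2] := partition_bounds jN.
have qj := partition_lt jN.
case/andP: s01 => s0 s1.
have h1 : 0 <= s * (q j.+1 - q j) by rewrite mulr_ge0// subr_ge0 ltW.
have h2 : 0 <= (1 - s) * (q j.+1 - q j) by rewrite mulr_ge0// subr_ge0// ltW.
by apply/andP; split; lra.
Qed.

End partition.

Lemma segment_point_rev (R : realType) (a b : R * R) (s : R) :
  segment_point a b (1 - s) = segment_point b a s.
Proof. by rewrite !segment_pointE; congr (_, _); ring. Qed.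

Lemma rev01 (R : realType) (s : R) : 0 <= s <= 1 -> 0 <= 1 - s <= 1.
Proof. by move=> /andP[s0 s1]; apply/andP; split; lra. Qed.

Lemma rev01_lt (R : realType) (s : R) : 0 < s < 1 -> 0 < 1 - s < 1.
Proof. by move=> /andP[s0 s1]; apply/andP; split; lra. Qed.

Lemma lt_le01 (R : realType) (s : R) : 0 < s < 1 -> 0 <= s <= 1.
Proof. by move=> /andP[/ltW -> /ltW ->]. Qed.

Lemma element_le (R : realType) (u v s : R) : u < v -> 0 <= s <= 1 ->
  u <= u + s * (v - u) <= v.
Proof.
move=> uv /andP[s0 s1].
have h1 : 0 <= s * (v - u) by rewrite mulr_ge0// subr_ge0 ltW.
have h2 : 0 <= (1 - s) * (v - u) by rewrite mulr_ge0// subr_ge0// ltW.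
by apply/andP; split; lra.
Qed.

Lemma element_lt (R : realType) (u v s : R) : u < v -> 0 < s < 1 ->
  u < u + s * (v - u) < v.
Proof.
move=> uv /andP[s0 s1].
have h1 : 0 < s * (v - u) by rewrite mulr_gt0// subr_gt0.
have h2 : 0 < (1 - s) * (v - u) by rewrite mulr_gt0// subr_gt0.
by apply/andP; split; lra.
Qed.

(** The integral of y dx along the polygonal curve, that is, the signed area
between the curve and the axis of abscissas. *)
Definition ydx (R : realType) (N : nat) (q : nat -> R) (X : R -> R * R) : R :=
  \sum_(j < N) (edge q X j).1 * ((X (q j)).2 + (X (q j.+1)).2) / 2.

Lemma simple_edges (R : realType) (N : nat) (q : nat -> R) (X : R -> R * R)
    (j k : nat) (s t : R) :
  I_partition N q -> Vh2 N q X -> {in `[0, 1] &, injective X} ->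
  (j < N)%N -> (k < N)%N -> 0 < s < 1 -> 0 <= t <= 1 ->
  segment_point (X (q j)) (X (q j.+1)) s =
  segment_point (X (q k)) (X (q k.+1)) t -> j = k.
Proof.
move=> hq hX injX jN kN s01 t01.
rewrite -!(Vh2_segment hq)//; last exact: lt_le01.
have js := element_lt (partition_lt hq jN) s01.
have kt := element_le (partition_lt hq kN) t01.
have in01 l u : (l < N)%N -> q l <= u <= q l.+1 -> u \in `[0, 1].
  move=> lN /andP[lu ul]; rewrite in_itv/=.
  have /andP[l0 _] := partition_bounds hq (ltnW lN).
  have /andP[_ l1] := partition_bounds hq lN.
  by rewrite (le_trans l0 lu) (le_trans ul l1).
move=> /injX rr; apply: (partition_inj hq jN kN js); rewrite rr//.
  by apply: (in01 j _ jN); case/andP: js => /ltW -> /ltW ->.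
exact: (in01 k _ kN).
Qed.

(** Two curves of a simple network meet at their endpoints only, and an interior
point of an edge has a parameter different from 0 and 1. *)
Lemma edge_off_curve (R : realType) (N : nat) (q : nat -> R)
    (X : R -> R * R) (Y : set (R * R)) (j : nat) (s : R) :
  I_partition N q -> Vh2 N q X -> {in `[0, 1] &, injective X} ->
  curve X `&` Y `<=` [set X 0; X 1] ->
  (j < N)%N -> 0 < s < 1 -> ~ Y (segment_point (X (q j)) (X (q j.+1)) s).
Proof.
move=> hq hX injX XY jN s01 Ys.
have js := element_lt (partition_lt hq jN) s01.
move: Ys; rewrite -(Vh2_segment hq)//; last exact: lt_le01.
move: (_ + _) js => r /andP[jr rj] Yr.
have /andP[l0 _] := partition_bounds hq (ltnW jN).
have /andP[_ l1] := partition_bounds hq jN.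
have r0 := le_lt_trans l0 jr; have r1 := lt_le_trans rj l1.
have r01 : r \in `[0, 1] by rewrite in_itv/= !ltW.
have := XY (X r) (conj (ex_intro2 _ _ r r01 erefl) Yr).
case=> /= /injX; rewrite !in_itv/= !lexx !ler01 => /(_ r01 isT) rE.
- by rewrite rE ltxx in r0.
- by rewrite rE ltxx in r1.
Qed.

(** The curve [X1] has [A] on its left and [X2] has [A] on its right, so that
[X1] followed by the reversal of [X2] runs around [A] counterclockwise. *)
Lemma area_between (R : realType) (N1 N2 : nat) (q1 q2 : nat -> R)
    (X1 X2 : R -> R * R) (A B C : set (R * R)) (M : R) :
  I_partition N1 q1 -> I_partition N2 q2 -> Vh2 N1 q1 X1 -> Vh2 N2 q2 X2 ->
  {in `[0, 1] &, injective X1} -> {in `[0, 1] &, injective X2} ->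
  curve X1 `&` curve X2 `<=` [set X1 0; X1 1] ->
  curve X1 `&` curve X2 `<=` [set X2 0; X2 1] ->
  open A -> (forall z, A z -> `|z.1| < M /\ `|z.2| < M) ->
  frontier A `<=` curve X1 `|` curve X2 ->
  A `&` B = set0 -> A `&` C = set0 ->
  normals_from_to N1 q1 X1 B A -> normals_from_to N2 q2 X2 A C ->
  area A = (ydx N2 q2 X2 - ydx N1 q1 X1)%:E.
Proof.
move=> hq1 hq2 hX1 hX2 inj1 inj2 X12 X21 oA AM frA AB AC n1 n2.
have nAB z : B z -> ~ A z by move=> Bz Az; have : (A `&` B) z by []; rewrite AB.
have nAC z : C z -> ~ A z by move=> Cz Az; have : (A `&` C) z by []; rewrite AC.
pose a (i : 'I_N1 + 'I_N2) :=
  match i with inl j => X1 (q1 j) | inr j => X2 (q2 j.+1) end.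
pose b (i : 'I_N1 + 'I_N2) :=
  match i with inl j => X1 (q1 j.+1) | inr j => X2 (q2 j) end.
rewrite (@polygon_area R _ a b A M)//; last first.
- move=> [j|j] s s01 /=.
    have := n1 j (ltn_ord j) s s01.
    by apply: filterS => e [/nAB].
  rewrite -segment_point_rev.
  have := n2 j (ltn_ord j) _ (rev01_lt s01).
  apply: filterS => e /= [h1 h2].
  have -> : perp (X2 (q2 j) - X2 (q2 j.+1)) = - perp (edge q2 X2 j).
    by rewrite /perp/=; congr (_, _); rewrite /= ?opprB ?opprK; ring.
  by rewrite scalerN opprK; split; [exact: nAC|exact: h1].
- move=> [j|j] [k|k] s t s01 t01 /=.
  + move=> /(simple_edges hq1 hX1 inj1 (ltn_ord j) (ltn_ord k) s01 t01) jk.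
    by congr inl; exact: val_inj.
  + move=> E; exfalso; apply: (edge_off_curve hq1 hX1 inj1 X12 (ltn_ord j) s01).
    rewrite E -segment_point_rev (curve_segments hq2 hX2); exists k => //=.
    by exists (1 - t) => //; rewrite /= in_itv/=; exact: rev01.
  + rewrite -segment_point_rev => E; exfalso.
    apply: (edge_off_curve (Y := curve X1) hq2 hX2 inj2 _ (ltn_ord j) (rev01_lt s01)).
      by rewrite setIC.
    rewrite E (curve_segments hq1 hX1); exists k => //=.
    by exists t => //; rewrite /= in_itv.
  + rewrite -(segment_point_rev _ _ s) -(segment_point_rev _ _ t).
    move=> /(simple_edges hq2 hX2 inj2 (ltn_ord j) (ltn_ord k) (rev01_lt s01) (rev01 t01)) jk.
    by congr inr; exact: val_inj.
- move=> z /frA[]; rewrite (curve_segments hq1 hX1, curve_segments hq2 hX2).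
    move=> [j /= jN [s]]; rewrite /= in_itv/= => s01 <-.
    by exists (inl (Ordinal jN)); exists s.
  move=> [j /= jN [s]]; rewrite /= in_itv/= => s01 <-.
  exists (inr (Ordinal jN)); exists (1 - s); first exact: rev01.
  by rewrite /= segment_point_rev.
congr EFin; rewrite big_sumType/= opprD addrC; congr (_ - _).
by rewrite -sumrN; apply: eq_bigr => j _; rewrite /edge/=; field.
Qed.

(** * Inner products on polygonal curves *)

Section element_integrals.
Variables (R : realType) (N : nat) (q : nat -> R) (X : R -> R * R).
Hypothesis hq : I_partition N q.

(** Continuity of [f] is needed on each closed element only: there the one-sided
limits in the lumped product are nodal values. *)
Lemma lumped_int_nodal (f : R -> R) :
  (forall j, (j < N)%N -> exists2 g : R -> R, continuous g &
     forall r, q j <= r <= q j.+1 -> f r = g r) ->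
  lumped_int N q X f =
  \sum_(j < N) enorm (edge q X j) * (f (q j) + f (q j.+1)) / 2.
Proof.
move=> fg; rewrite /lumped_int mulr_sumr; apply: eq_bigr => j _.
have [g cg fE] := fg j (ltn_ord j).
have qj := partition_lt hq (ltn_ord j).
have -> : lim (f r @[r --> (q j.+1)^'-]) = f (q j.+1).
  apply: cvg_lim => //; rewrite fE ?lexx ?ltW//.
  apply: cvg_trans (cvg_at_left_filter (cg (q j.+1))).
  apply: near_eq_cvg; near=> r.
  rewrite fE//; apply/andP; split; last by near: r; exact: nbhs_left_le.
  by near: r; exact: nbhs_left_ge.
have -> : lim (f r @[r --> (q j)^'+]) = f (q j).
  apply: cvg_lim => //; rewrite fE ?lexx ?ltW//.
  apply: cvg_trans (cvg_at_right_filter (cg (q j))).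
  apply: near_eq_cvg; near=> r.
  rewrite fE//; apply/andP; split; first by near: r; exact: nbhs_right_ge.
  by near: r; exact: nbhs_right_le.
by field.
Unshelve. all: end_near. Qed.

Lemma enorm_deriv2 j r : Vh2 N q X -> (j < N)%N -> q j < r < q j.+1 ->
  enorm (deriv2 X r) = enorm (edge q X j) / (q j.+1 - q j).
Proof.
move=> [X1 X2] jN rj; have qj := partition_lt hq jN.
have der : forall u w d z : R,
    'D_1 (fun r : R => u + (r - z) / d * w) r = w / d.
  move=> u w d z.
  suff : is_derive r (1 : R) (fun r : R => u + (r - z) / d * w) (w / d).
    by move=> dr; exact: derive_val.
  by apply: is_derive_eq; rewrite /GRing.scale/=; ring.
have dv (v : R -> R) : Vh N q v ->
    derive1 v r = (v (q j.+1) - v (q j)) / (q j.+1 - q j).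
  move=> hv; rewrite derive1E; case/andP: rj => r1 r2.
  have -> : 'D_1 v r = 'D_1 (fun r : R => v (q j) + (r - q j) / (q j.+1 - q j) * (v (q j.+1) - v (q j))) r.
    apply: near_eq_derive; near=> z; apply: (Vh_affine hq hv jN).
    apply/andP; split; first by rewrite ltW//; near: z; exact: lt_nbhsr.
    by rewrite ltW//; near: z; exact: lt_nbhsl.
  exact: der.
have pos : 0 < q j.+1 - q j by rewrite subr_gt0.
rewrite /enorm /deriv2 /dot /= !dv// /edge/=.
have sq (a b d : R) : 0 < d ->
    Num.sqrt (a / d * (a / d) + b / d * (b / d)) = Num.sqrt (a * a + b * b) / d.
  move=> d0; rewrite (_ : _ + _ = (a * a + b * b) * (d ^-1) ^+ 2); last by ring.
  rewrite sqrtrM ?sqrtr_sqr; last by rewrite -!expr2 addr_ge0 ?sqr_ge0.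
  by rewrite ger0_norm// invr_ge0 ltW.
exact: sq.
Unshelve. all: end_near. Qed.

Lemma curve_int_affine (f : R -> R) (c d : nat -> R) : Vh2 N q X ->
  (forall j, (j < N)%N -> forall r, q j < r < q j.+1 -> f r = c j * r + d j) ->
  curve_int X f =
  \sum_(j < N) enorm (edge q X j) *
    ((c j * q j + d j) + (c j * q j.+1 + d j)) / 2.
Proof.
move=> hX fE; rewrite /curve_int Rintegral_mkcond /Rintegral.
pose e j := enorm (edge q X j) / (q j.+1 - q j).
have [||_ ->] := @integral_affine_pieces R 'I_N (fun j => q j)
  (fun j => q j.+1) (fun j => c j * e j) (fun j => d j * e j)
  [seq q j | j <- iota 0 N.+1] ((fun r => f r * enorm (deriv2 X r)) \_ `[0, 1]).
- by move=> j; exact/ltW/(partition_lt hq).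
- move=> x xS; rewrite patchE mem_setE; case: ifPn => [x01|x01]; last first.
    rewrite big1// => j _; rewrite indicE memNset ?mul0r//= in_itv/=.
    move=> /andP[jx xj]; move: x01; rewrite in_itv/=.
    have /andP[l0 _] := partition_bounds hq (ltnW (ltn_ord j)).
    have /andP[_ l1] := partition_bounds hq (ltn_ord j).
    by rewrite (le_trans l0 (ltW jx)) (le_trans (ltW xj) l1).
  move: x01; rewrite in_itv/= => /(partition_locate hq)[j jN /andP[jx xj]].
  have nS k : (k <= N)%N -> x != q k.
    by move=> kN; apply: contra xS => /eqP ->; apply: map_f; rewrite mem_iota.
  have xj' : q j < x < q j.+1.
    by rewrite !lt_neqAle jx xj nS// eq_sym nS// ltnW.
  rewrite (bigD1 (Ordinal jN))//= big1 => [|k kj].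
    rewrite indicE mem_set/= ?in_itv/=// (fE j)// (enorm_deriv2 (j := j))//.
    by rewrite -/(e j); ring.
  rewrite indicE memNset ?mul0r//= in_itv/= => /andP[kx xk].
  move/eqP: kj; apply; apply: val_inj => /=.
  by apply: (partition_inj hq (ltn_ord k) jN (r := x)); apply/andP.
rewrite /=; apply: eq_bigr => j _; rewrite /e; field.
by rewrite subr_eq0 gt_eqF// (partition_lt hq).
Qed.

End element_integrals.

(** The increments of the elements before the current one telescope, and those
of the elements after it are clipped to zero. *)
Lemma interp_element (R : realType) (N : nat) (q f : nat -> R) (g : R -> R)
    (j : nat) (r : R) :
  I_partition N q -> (j < N)%N -> q j <= r <= q j.+1 ->
  interp N q g r =
  g (q j) + (r - q j) / (q j.+1 - q j) * (g (q j.+1) - g (q j)).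
Proof.
move=> hq jN /andP[jr rj]; rewrite /interp.
pose F k := (g (q k.+1) - g (q k)) *
  Num.max 0 (Num.min 1 ((r - q k) / (q k.+1 - q k))).
rewrite -(big_mkord predT F) (big_cat_nat (n := j))//=; last exact: ltnW.
rewrite [X in _ + (_ + X)]big_ltn//.
have qlt k : (k < N)%N -> 0 < q k.+1 - q k.
  by move=> kN; rewrite subr_gt0 (partition_lt hq).
have -> : \sum_(0 <= k < j) F k = g (q j) - g (q 0%N).
  rewrite -(telescope_sumr (fun k => g (q k)))//; apply: eq_big_nat => k /andP[_ kj].
  have kN := ltn_trans kj jN.
  rewrite /F min_l ?max_r ?mulr1//.
  rewrite ler_pdivlMr ?qlt// mul1r lerB//.
  by apply: le_trans jr; apply: (partition_le hq) => //; exact: ltnW.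
have -> : \sum_(j.+1 <= k < N) F k = 0.
  rewrite big_nat_cond big1// => k; rewrite andbT => /andP[jk kN].
  have le0 : (r - q k) / (q k.+1 - q k) <= 0.
    rewrite pmulr_lle0 ?invr_gt0 ?qlt// subr_le0; apply: le_trans rj _.
    by apply: (partition_le hq) => //; exact: ltnW.
  by rewrite /F max_l ?mulr0// ge_min le0 orbT.
have -> : F j = (r - q j) / (q j.+1 - q j) * (g (q j.+1) - g (q j)).
  rewrite /F mulrC; congr (_ * _).
  rewrite min_r; last by rewrite ler_pdivrMr ?qlt// mul1r lerB.
  by rewrite max_r// divr_ge0// ?subr_ge0// ltW// -subr_gt0 qlt.
by rewrite addr0 addrA (addrC (g (q 0%N))) subrK.
Qed.

(** The trapezoidal rule is exact on affine functions, hence mass lumping makes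
no difference for an interpolant times a constant. *)
Lemma opt_int_interp (R : realType) (lumped : bool) (N : nat) (q : nat -> R)
    (X : R -> R * R) (g : R -> R) (m : R) :
  I_partition N q -> Vh2 N q X ->
  opt_int lumped N q X (fun r => interp N q g r * m) =
  m * \sum_(j < N) enorm (edge q X j) * (g (q j) + g (q j.+1)) / 2.
Proof.
move=> hq hX.
have intE j r : (j < N)%N -> q j <= r <= q j.+1 -> interp N q g r = _ :=
  fun jN => @interp_element R N q q g j r hq jN.
pose c j := (g (q j.+1) - g (q j)) / (q j.+1 - q j).
have qlt (j : 'I_N) : q j.+1 - q j != 0.
  by rewrite subr_eq0 gt_eqF// (partition_lt hq).
have nodes (j : 'I_N) : interp N q g (q j) = g (q j) /\
    interp N q g (q j.+1) = g (q j.+1).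
  have qj := ltW (partition_lt hq (ltn_ord j)).
  rewrite !(intE j) ?lexx ?qj//; split; first by rewrite subrr !mul0r addr0.
  by rewrite divff// mul1r addrC subrK.
rewrite mulr_sumr /opt_int; case: lumped.
  rewrite (lumped_int_nodal _ hq); last first.
    move=> j jN.
    exists (fun r => (g (q j) + (r - q j) / (q j.+1 - q j) * (g (q j.+1) - g (q j))) * m).
      move=> r; apply: cvgM; last exact: cvg_cst.
      apply: cvgD; first exact: cvg_cst.
      apply: cvgM; last exact: cvg_cst.
      apply: cvgM; last exact: cvg_cst.
      by apply: cvgB; [exact: cvg_id|exact: cvg_cst].
    by move=> r rj; rewrite (intE j).
  apply: eq_bigr => j _; have [-> ->] := nodes j; ring.
rewrite (curve_int_affine hq (c := fun j => c j * m)
  (d := fun j => (g (q j) - q j * c j) * m))//; last first.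
  move=> j jN r /andP[/ltW jr /ltW rj].
  by rewrite (intE j) ?jr//; rewrite /c; ring.
by apply: eq_bigr => j _; rewrite /c; field.
Qed.

Lemma lumped_int_dot (R : realType) (N : nat) (q : nat -> R)
    (X u v : R -> R * R) :
  I_partition N q -> Vh2 N q u -> Vh2 N q v ->
  lumped_int N q X (fun r => dot (u r) (v r)) =
  \sum_(j < N) enorm (edge q X j) *
    (dot (u (q j)) (v (q j)) + dot (u (q j.+1)) (v (q j.+1))) / 2.
Proof.
move=> hq [u1 u2] [v1 v2]; rewrite lumped_int_nodal// => j jN.
case: u1 u2 v1 v2 => _ u1 [_ u2] [_ v1] [_ v2].
have [a1 [b1 u1E]] := u1 j jN; have [a2 [b2 u2E]] := u2 j jN.
have [a3 [b3 v1E]] := v1 j jN; have [a4 [b4 v2E]] := v2 j jN.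
exists (fun r => (a1 * r + b1) * (a3 * r + b3) + (a2 * r + b2) * (a4 * r + b4)).
  have aff (a b : R) : continuous (fun r : R => a * r + b).
    move=> r; apply: cvgD; last exact: cvg_cst.
    by apply: cvgM; [exact: cvg_cst|exact: cvg_id].
  by move=> r; apply: cvgD; apply: cvgM; exact: aff.
by move=> r rj; rewrite /dot u1E// u2E// v1E// v2E.
Qed.

(** True for a degenerate edge too, where both sides vanish. *)
Lemma enorm_perp (R : realType) (u : R * R) :
  enorm u *: ((enorm u)^-1 *: perp u) = perp u.
Proof.
have [u0|u0] := eqVneq (enorm u) 0; last by rewrite scalerA mulfV// scale1r.
have [u1 u2] : u.1 = 0 /\ u.2 = 0.
  move/eqP: u0; rewrite /enorm sqrtr_eq0 /dot => u0; split; nra.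
by rewrite u0 scale0r /perp u1 u2 oppr0.
Qed.

(** Edges depend linearly on time, so the time average of the rotated edge is the
rotation of the mean of its first and last positions. *)
Lemma nu_edgeE (R : realType) (t0 t1 : R) (q : nat -> R) (X0 X1 : R -> R * R)
    (j : nat) :
  t0 < t1 ->
  nu_edge t0 t1 q X0 X1 j = (enorm (edge q X0 j))^-1 *:
    perp (2^-1 *: (edge q X0 j + edge q X1 j)).
Proof.
move=> t01; rewrite /nu_edge /unit_normal; cbv zeta beta.
have tt : t1 - t0 != 0 by rewrite subr_eq0 gt_eqF.
have eE s : edge q (Xh t0 t1 X0 X1 s) j =
    ((t1 - s) / (t1 - t0)) *: edge q X0 j + ((s - t0) / (t1 - t0)) *: edge q X1 j.
  by rewrite /edge /Xh !scalerBr opprD addrACA.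
have int (a b : R) : \int[lebesgue_measure]_(s in `[t0, t1])
    ((t1 - s) / (t1 - t0) * a + (s - t0) / (t1 - t0) * b) =
    (t1 - t0) * (a + b) / 2.
  transitivity (\int[lebesgue_measure]_(s in `[t0, t1])
      ((b - a) / (t1 - t0) * s + (t1 * a - t0 * b) / (t1 - t0))).
    by apply: eq_Rintegral => s _; ring.
  by rewrite /Rintegral integral_affine//=; field.
have -> : \int[lebesgue_measure]_(s in `[t0, t1])
    (enorm (edge q (Xh t0 t1 X0 X1 s) j) *:
     ((enorm (edge q (Xh t0 t1 X0 X1 s) j))^-1 *:
      perp (edge q (Xh t0 t1 X0 X1 s) j))).1 =
    (t1 - t0) * (- (edge q X0 j).2 + - (edge q X1 j).2) / 2.
  rewrite -int; apply: eq_Rintegral => s _.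
  by rewrite enorm_perp eE /perp/= /GRing.scale/=; ring.
have -> : \int[lebesgue_measure]_(s in `[t0, t1])
    (enorm (edge q (Xh t0 t1 X0 X1 s) j) *:
     ((enorm (edge q (Xh t0 t1 X0 X1 s) j))^-1 *:
      perp (edge q (Xh t0 t1 X0 X1 s) j))).2 =
    (t1 - t0) * ((edge q X0 j).1 + (edge q X1 j).1) / 2.
  rewrite -int; apply: eq_Rintegral => s _.
  by rewrite enorm_perp eE /perp/= /GRing.scale/=; ring.
rewrite invfM; set e := (enorm _)^-1.
by rewrite /perp /GRing.scale/=; congr (_, _); rewrite /GRing.scale/=; field.
Qed.

(** * Increment of the area under a polygonal curve *)

Lemma pair_scaleE (R : realType) (a : R) (u : R * R) :
  a *: u = (a * u.1, a * u.2).
Proof. by []. Qed.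

(** The integral over the old curve of the displacement against the time-averaged
normal: on each edge, the mean rotated edge times the mean displacement. *)
Definition flux (R : realType) (N : nat) (q : nat -> R) (X0 X1 : R -> R * R) : R :=
  \sum_(j < N) dot (perp (2^-1 *: (edge q X0 j + edge q X1 j)))
    (2^-1 *: ((X1 (q j) - X0 (q j)) + (X1 (q j.+1) - X0 (q j.+1)))).

(** On an edge, [ydx] is the product of an increment of the abscissa and a mean of
the ordinate.  Differences of products are exact at time midpoints, and a
discrete summation by parts turns the increments of the displacement into
increments of the ordinate; [T] is the boundary term it leaves. *)
Lemma ydx_increment (R : realType) (N : nat) (q : nat -> R) (X0 X1 : R -> R * R) :
  I_partition N q ->
  let T r := ((X1 r).1 - (X0 r).1) * ((X0 r).2 + (X1 r).2) / 2 in
  ydx N q X1 - ydx N q X0 = flux N q X0 X1 + (T 1 - T 0).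
Proof.
move=> [_ q0 qN _] T.
rewrite (_ : T 1 - T 0 = T (q N) - T (q 0%N)); last by rewrite q0 qN.
rewrite -(telescope_sumr (fun k => T (q k)))// big_mkord.
rewrite /ydx /flux -sumrB -big_split/=; apply: eq_bigr => j _.
by rewrite /T !pair_scaleE /dot /perp /edge/=; field.
Qed.

Lemma nu_half_element (R : realType) (t0 t1 : R) (N : nat) (q : nat -> R)
    (X0 X1 : R -> R * R) (j : nat) (r : R) :
  I_partition N q -> (j < N)%N -> q j < r < q j.+1 ->
  nu_half t0 t1 N q X0 X1 r = nu_edge t0 t1 q X0 X1 j.
Proof.
move=> hq jN rj; rewrite /nu_half (bigD1 (Ordinal jN))//= big1 ?addr0//.
move=> k /andP[/andP[kr rk]] /eqP kj; case: kj; apply: val_inj => /=.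
by apply: (partition_inj hq (ltn_ord k) jN (r := r)); rewrite ?kr//;
  case/andP: rj => /ltW -> /ltW ->.
Qed.

Lemma Vh2B (R : realType) (N : nat) (q : nat -> R) (X0 X1 : R -> R * R) :
  Vh2 N q X0 -> Vh2 N q X1 -> Vh2 N q (fun r => X1 r - X0 r).
Proof.
have VhB (u v : R -> R) : Vh N q u -> Vh N q v -> Vh N q (fun r => v r - u r).
  move=> [cu au] [cv av]; split.
    by move=> r; apply: cvgB; [exact: cv|exact: cu].
  move=> j jN; have [a [b uE]] := au j jN; have [c [d vE]] := av j jN.
  exists (c - a), (d - b) => r rj; rewrite uE// vE//; ring.
by move=> [u1 u2] [v1 v2]; split; exact: VhB.
Qed.

(** The displacement is itself an admissible test function in the equation that
defines the weighted normal. *)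
Lemma omega_flux (R : realType) (t0 t1 : R) (N : nat) (q : nat -> R)
    (X0 X1 omega : R -> R * R) :
  t0 < t1 -> I_partition N q -> Vh2 N q X0 -> Vh2 N q X1 ->
  (forall j, (j < N)%N -> 0 < enorm (edge q X0 j)) ->
  is_omega_half t0 t1 N q X0 X1 omega ->
  \sum_(j < N) enorm (edge q X0 j) *
    (dot (omega (q j)) (X1 (q j) - X0 (q j)) +
     dot (omega (q j.+1)) (X1 (q j.+1) - X0 (q j.+1))) / 2 = flux N q X0 X1.
Proof.
move=> t01 hq h0 h1 e0 [homega omegaE].
have hxi := Vh2B h0 h1.
have := omegaE _ hxi; rewrite lumped_int_dot// => ->.
case: (hxi) => -[_ x1] [_ x2].
have affine_coefs (f : R -> R) :
    (forall j, (j < N)%N -> exists a b : R, forall r,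
       q j <= r <= q j.+1 -> f r = a * r + b) ->
    exists c : nat -> R * R, forall j, (j < N)%N -> forall r,
      q j <= r <= q j.+1 -> f r = (c j).1 * r + (c j).2.
  move=> H.
  suff /choice[c cE] : forall j, exists c : R * R, (j < N)%N -> forall r,
      q j <= r <= q j.+1 -> f r = c.1 * r + c.2 by exists c.
  move=> j.
  have [jN|_] := boolP (j < N)%N; last by exists 0.
  by have [a [b ab]] := H j jN; exists (a, b).
have [c1 c1E] := affine_coefs _ x1.
have [c2 c2E] := affine_coefs _ x2.
pose nu := nu_edge t0 t1 q X0 X1.
rewrite (curve_int_affine hq
  (c := fun j => (nu j).1 * (c1 j).1 + (nu j).2 * (c2 j).1)
  (d := fun j => (nu j).1 * (c1 j).2 + (nu j).2 * (c2 j).2))//; last first.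
  move=> j jN r rj; rewrite (nu_half_element _ _ _ _ hq jN rj) /dot.
  have rj' : q j <= r <= q j.+1 by case/andP: rj => /ltW -> /ltW ->.
  by rewrite (c1E j jN r rj') (c2E j jN r rj') -/(nu j); ring.
apply: eq_bigr => j _.
have qj := ltW (partition_lt hq (ltn_ord j)).
have n1 : q j <= q j <= q j.+1 by rewrite lexx.
have n2 : q j <= q j.+1 <= q j.+1 by rewrite lexx qj.
have a1 := c1E j (ltn_ord j) _ n1; have a2 := c1E j (ltn_ord j) _ n2.
have b1 := c2E j (ltn_ord j) _ n1; have b2 := c2E j (ltn_ord j) _ n2.
have ej := lt0r_neq0 (e0 j (ltn_ord j)).
transitivity (enorm (edge q X0 j) * ((nu j).1 * ((X1 (q j) - X0 (q j)).1 + (X1 (q j.+1) - X0 (q j.+1)).1)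
  + (nu j).2 * ((X1 (q j) - X0 (q j)).2 + (X1 (q j.+1) - X0 (q j.+1)).2)) / 2).
  by rewrite a1 a2 b1 b2; ring.
rewrite /nu nu_edgeE// !pair_scaleE /dot /perp/=; field.
exact: ej.
Qed.

Lemma grad_ip_cst (R : realType) (Omega : set (R * R))
    (W : 'I_3 -> R * R -> R) (c : 'I_3 -> R) :
  grad_ip Omega W (fun j _ => c j) = 0.
Proof.
rewrite /grad_ip big1// => j _.
rewrite /Rintegral integral0_eq// => x _.
have dc (v : R * R) : 'D_v (fun=> c j : R) x = 0 by exact: derive_cst.
by rewrite /dot /grad !dc/= !mulr0 addr0.
Qed.

Lemma SmSigma_cst (R : realType) (Omega : set (R * R))
    (Th : seq (3.-tuple (R * R))) (c : 'I_3 -> R) :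
  c i1 + c i2 + c i3 = 0 -> SmSigma Omega Th (fun j _ => c j).
Proof.
move=> c0; split=> // j; split; first by move=> x; exact: cvg_cst.
by move=> o _; exists 0, (c j) => x _; rewrite /dot/= !mul0r !add0r.
Qed.

(** * Areas of the three regions *)

Lemma curve_null (R : realType) (N : nat) (q : nat -> R) (X : R -> R * R) :
  I_partition N q -> Vh2 N q X ->
  measurable (curve X : set (measurableTypeR R * measurableTypeR R)) /\
  area (curve X) = 0%:E.
Proof.
move=> hq hX; rewrite (curve_segments hq hX).
set F := fun j => [set segment_point _ _ s | s in `[0, 1]].
have mF j : measurable (F j : set (measurableTypeR R * measurableTypeR R)).
  exact: measurable_segment.
have mU : measurable (\bigcup_(j in [set j | (j < N)%N]) F j :
    set (measurableTypeR R * measurableTypeR R)).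
  by apply: bigcup_measurable => j _; exact: mF.
split => //.
pose mu2 : {measure set (measurableTypeR R * measurableTypeR R) -> \bar R} :=
  (@lebesgue_measure R \x @lebesgue_measure R)%E.
have nF j : mu2.-negligible (F j).
  by apply/(negligibleP _ (mF j)); exact: segment_area0.
apply: (measure_negligible (mu := mu2) mU).
apply: negligibleS (negligible_bigcup nF).
by move=> z [j _ Fz]; exists j.
Qed.

(** The domain is the disjoint union of the three regions and of the curves, and
the latter are null. *)
Lemma network_area (R : realType) (N : 'I_3 -> nat) (q : 'I_3 -> nat -> R)
    (Omega : set (R * R)) (X : 'I_3 -> R -> R * R) (Om : 'I_3 -> set (R * R)) :
  (forall i, I_partition (N i) (q i)) -> Vnet2 N q X ->
  (forall i, curve (X i) `<=` Omega) -> network_partition Omega X Om ->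
  area Omega = (area (Om i1) + area (Om i2) + area (Om i3))%E.
Proof.
move=> hq [hX _ _] XO [oOm disj cover _].
have mOm j : measurable (Om j : set (measurableTypeR R * measurableTypeR R)).
  exact: open_measurable_plane.
have I3 (j : 'I_3) : [\/ j = i1, j = i2 | j = i3].
  by case: j => -[|[|[|//]]] p; [constructor 1|constructor 2|constructor 3];
    apply: val_inj.
pose mu2 : {measure set (measurableTypeR R * measurableTypeR R) -> \bar R} :=
  (@lebesgue_measure R \x @lebesgue_measure R)%E.
pose S : set (measurableTypeR R * measurableTypeR R) :=
  curve (X i1) `|` curve (X i2) `|` curve (X i3).
have mC i := (curve_null (hq i) (hX i)).1.
have mS : measurable S by apply: measurableU => //; exact: measurableU.
have S0 : area S = 0%:E.
  have nC i : mu2.-negligible (curve (X i)).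
    by apply/(negligibleP _ (mC i)); exact: (curve_null (hq i) (hX i)).2.
  apply: (measure_negligible (mu := mu2) mS).
  by apply: negligibleU => //; exact: negligibleU.
have SE : S = \bigcup_i curve (X i).
  apply/seteqP; split => z.
    by move=> [[]|]; [exists i1|exists i2|exists i3].
  by move=> [i _]; have [->|->|->] := I3 i; [left; left|left; right|right].
have OmE : Omega `\` S = Om i1 `|` Om i2 `|` Om i3.
  rewrite SE -cover; apply/seteqP; split => z; last first.
    by move=> [[]|]; [exists i1|exists i2|exists i3].
  by move=> [i _]; have [->|->|->] := I3 i; [left; left|left; right|right].
have OE : Omega = (Om i1 `|` Om i2 `|` Om i3) `|` S.
  rewrite -OmE setUC setDUK// => z; rewrite SE => -[i _]; exact: XO.
have areaU (A B : set (measurableTypeR R * measurableTypeR R)) :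
    measurable A -> measurable B -> A `&` B = set0 ->
    area (A `|` B) = (area A + area B)%E.
  exact: (measureU mu2).
rewrite {1}OE areaU ?S0 ?adde0//.
- rewrite areaU//; last by rewrite setIUl !disj// setU0.
  + by rewrite areaU// disj.
  + exact: measurableU.
- by apply: measurableU => //; exact: measurableU.
- by rewrite -OmE setIC setDIK.
Qed.

(** Constant triples of zero sum are test functions of the bulk equation, for which
it becomes a linear relation between the three fluxes. *)
Lemma bulk_eq_flux (R : realType) (lumped : bool) (Omega : set (R * R))
    (Th : seq (3.-tuple (R * R))) (N : 'I_3 -> nat) (q : 'I_3 -> nat -> R)
    (t0 t1 : R) (X0 X1 omega : 'I_3 -> R -> R * R) (W : 'I_3 -> R * R -> R) :
  t0 < t1 -> (forall i, I_partition (N i) (q i)) ->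
  (forall i, Vh2 (N i) (q i) (X0 i)) -> (forall i, Vh2 (N i) (q i) (X1 i)) ->
  (forall i j, (j < N i)%N -> 0 < enorm (edge (q i) (X0 i) j)) ->
  (forall i, is_omega_half t0 t1 (N i) (q i) (X0 i) (X1 i) (omega i)) ->
  bulk_eq lumped Omega Th N q (t1 - t0) X0 X1 omega W ->
  let D i := flux (N i) (q i) (X0 i) (X1 i) in
  D i1 = D i2 /\ D i2 = D i3.
Proof.
move=> t01 hq h0 h1 e0 homega hbulk D.
have tau0 : t1 - t0 != 0 by rewrite subr_eq0 gt_eqF.
have term (i : 'I_3) (c : R) : opt_int lumped (N i) (q i) (X0 i) (fun r =>
    interp (N i) (q i)
      (fun s => dot ((t1 - t0)^-1 *: (X1 i s - X0 i s)) (omega i s)) r * c) =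
    c * ((t1 - t0)^-1 * D i).
  rewrite opt_int_interp//; congr (_ * _).
  rewrite /D -(omega_flux t01 (hq i) (h0 i) (h1 i) (e0 i) (homega i)) mulr_sumr.
  by apply: eq_bigr => j _; rewrite !pair_scaleE /dot/=; ring.
have key c1 c2 c3 : c1 + c2 + c3 = 0 ->
    (c3 - c2) * D i1 + (c1 - c3) * D i2 + (c2 - c1) * D i3 = 0.
  move=> c0.
  pose c (i : 'I_3) : R := nth 0 [:: c1; c2; c3] i.
  have := hbulk _ (@SmSigma_cst R Omega Th c c0).
  rewrite grad_ip_cst sub0r /Lambda !big_cons big_nil !term /c/= addr0.
  move=> /eqP; rewrite oppr_eq0 => /eqP H.
  apply: (mulfI (invr_neq0 tau0)); rewrite mulr0 -[RHS]H; ring.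
(* These two triples span the zero-sum constants; the relations they give are
   3 (D i2 - D i3) = 0 and 3 (D i3 - D i1) = 0. *)
have e1 := key 2 (-1) (-1); have e2 := key (-1) 2 (-1).
by split; lra.
Qed.

(** The first region lies on the left of curve 2 and on the right of curve 3, the
second one on the left of curve 3 and on the right of curve 1. *)
Lemma region_areas (R : realType) (N : 'I_3 -> nat) (q : 'I_3 -> nat -> R)
    (Omega : set (R * R)) (X : 'I_3 -> R -> R * R) (Om : 'I_3 -> set (R * R)) :
  bounded_set Omega ->
  (forall i, I_partition (N i) (q i)) -> (forall i, Vh2 (N i) (q i) (X i)) ->
  simple_network Omega X -> network_partition Omega X Om ->
  oriented_network N q X Om ->
  let L i := ydx (N i) (q i) (X i) in
  area (Om i1) = (L i3 - L i2)%:E /\ area (Om i2) = (L i1 - L i3)%:E.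
Proof.
move=> [M [_ bM]] hq hX [XO inj meet] [oOm disj cover [fr1 fr2 _]] [n1 n2 n3] L.
have OmO j z : Om j z -> `|z.1| < M + 2 /\ `|z.2| < M + 2.
  move=> Oz; have : (\bigcup_j Om j) z by exists j.
  rewrite cover => -[/(bM (M + 1))]; rewrite ltrDl ltr01 => /(_ isT) zM _.
  have {}zM : Num.max `|z.1| `|z.2| <= M + 1 by exact: zM.
  by move: zM; rewrite ge_max => /andP[z1 z2]; split; lra.
split.
- apply: (@area_between R _ _ (q i2) (q i3) (X i2) (X i3) (Om i1) (Om i3) (Om i2) (M + 2)) => //.
  + by rewrite meet.
  + by rewrite setIC meet.
  + exact: OmO.
  + by rewrite fr1.
  + by rewrite disj.
  + by rewrite disj.
- apply: (@area_between R _ _ (q i3) (q i1) (X i3) (X i1) (Om i2) (Om i1) (Om i3) (M + 2)) => //.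
  + by rewrite meet.
  + by rewrite setIC meet.
  + exact: OmO.
  + by rewrite fr2 setUC.
  + by rewrite disj.
  + by rewrite disj.
Qed.

Lemma EFin_addI (R : realType) (r : R) (x y : \bar R) :
  (r%:E + x = r%:E + y)%E -> x = y.
Proof. by case: x y => [x| |] [y| |]//= [/addrI ->]. Qed.

Unset Implicit Arguments.

Theorem theorem6p2 (R : realType)
    (Omega : set (R * R)) (hOmega : bounded_domain Omega)
    (Th : seq (3.-tuple (R * R))) (hTh : triangulation Th (closure Omega))
    (sigma : 'I_3 -> R) (hsigma : forall i, 0 < sigma i)
    (hsigma1 : sigma i1 <= sigma i2 + sigma i3)
    (hsigma2 : sigma i2 <= sigma i1 + sigma i3)
    (hsigma3 : sigma i3 <= sigma i1 + sigma i2)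
    (N : 'I_3 -> nat) (q : 'I_3 -> nat -> R)
    (hq : forall i, I_partition (N i) (q i))
    (m : nat) (t : nat -> R) (ht : 0 < t m.+1 - t m)
    (X : nat -> 'I_3 -> R -> R * R) (kappa : nat -> 'I_3 -> R -> R)
    (W : nat -> 'I_3 -> R * R -> R) (Om : nat -> 'I_3 -> set (R * R))
    (omega : 'I_3 -> R -> R * R) (lumped : bool)
    (hXm : Vnet2 N q (X m)) (hkappam : Vnet N q (kappa m))
    (hedge : forall i j, (j < N i)%N -> 0 < enorm (edge (q i) (X m i) j))
    (hWm1 : SmSigma Omega Th (W m.+1))
    (hXm1 : Vnet2 N q (X m.+1)) (hkappam1 : Vnet N q (kappa m.+1))
    (hsimple : forall n, n = m \/ n = m.+1 -> simple_network Omega (X n))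
    (hOm : forall n, n = m \/ n = m.+1 -> network_partition Omega (X n) (Om n))
    (hnormal : forall n, n = m \/ n = m.+1 -> oriented_network N q (X n) (Om n))
    (homega : forall i,
      is_omega_half (t m) (t m.+1) (N i) (q i) (X m i) (X m.+1 i) (omega i))
    (hbulk : bulk_eq lumped Omega Th N q (t m.+1 - t m)
      (X m) (X m.+1) omega (W m.+1))
    (hcurvature : curvature_eq lumped N q (X m) (kappa m.+1) (W m.+1))
    (hforce : force_eq N q sigma (X m) (X m.+1) omega (kappa m.+1)) :
  forall j : 'I_3, area (Om m.+1 j) = area (Om m j).
Proof.
have [_ _ _ bO] := hOmega.
have t01 : t m < t m.+1 by rewrite -subr_gt0.
case: (hXm) (hXm1) => hm [m12 m23] [m12' m23'] [hm1 [n12 n23] [n12' n23']].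
have [D12 D23] := bulk_eq_flux t01 hq hm hm1 hedge homega hbulk.
have hm' : m = m \/ m = m.+1 by left.
have hm1' : m.+1 = m \/ m.+1 = m.+1 by right.
have [a1 a2] := region_areas bO hq hm (hsimple _ hm') (hOm _ hm') (hnormal _ hm').
have [b1 b2] := region_areas bO hq hm1 (hsimple _ hm1') (hOm _ hm1') (hnormal _ hm1').
have incr i := ydx_increment (X m i) (X m.+1 i) (hq i).
have inc12 : ydx (N i1) (q i1) (X m.+1 i1) - ydx (N i1) (q i1) (X m i1) =
    ydx (N i2) (q i2) (X m.+1 i2) - ydx (N i2) (q i2) (X m i2).
  by rewrite !incr D12 m12 m12' n12 n12'.
have inc23 : ydx (N i2) (q i2) (X m.+1 i2) - ydx (N i2) (q i2) (X m i2) =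
    ydx (N i3) (q i3) (X m.+1 i3) - ydx (N i3) (q i3) (X m i3).
  by rewrite !incr D23 m23 m23' n23 n23'.
have A1 : area (Om m.+1 i1) = area (Om m i1).
  by rewrite a1 b1; congr EFin; lra.
have A2 : area (Om m.+1 i2) = area (Om m i2).
  by rewrite a2 b2; congr EFin; lra.
have A3 : area (Om m.+1 i3) = area (Om m i3).
  have [[XO _ _] [XO' _ _]] := (hsimple _ hm', hsimple _ hm1').
  have := network_area hq hXm1 XO' (hOm _ hm1').
  rewrite (network_area hq hXm XO (hOm _ hm')) A1 A2 a1 a2 -EFinD.
  by move/EFin_addI.
case=> -[|[|[|//]]] p.
- by rewrite (_ : Ordinal p = i1)//; exact: val_inj.
- by rewrite (_ : Ordinal p = i2)//; exact: val_inj.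
- by rewrite (_ : Ordinal p = i3)//; exact: val_inj.
Qed.
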